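(* Let $\kappa,\beta>0$ and consider the equation $\kappa u_{tt}+iu_t+\beta u_{xx}+f(u)=0$ for a complex-valued $u=u(x,t)$, $x\in\mathbb{R}$, $t\geq 0$, where $f$ satisfies $f(z)=\frac{\partial V(z)}{\partial\overline z}$ for some smooth, real-valued potential $V$, with the normalization $\mathrm{Re}\,f(p,q)=\frac{\partial V}{\partial p}(p,q)$, $\mathrm{Im}\,f(p,q)=\frac{\partial V}{\partial q}(p,q)$ for $z=p+iq$. Write $u=p+iq$, $u_t=\phi+i\varphi$, and define, on a suitable functional space for $(p,q,\phi,\varphi)$, $$\mathcal{H}(p,q,\phi,\varphi)=\int_{-\infty}^{\infty}\left(\frac{\beta}{2}(p_x^2+q_x^2)-V(p,q)-\frac{\kappa}{2}(\phi^2+\varphi^2)\right)dx,$$ $$\mathcal{I}_2(p,q,\phi,\varphi)=\int_{-\infty}^{\infty}\left(-\kappa(p_x\phi+q_x\varphi)+\frac12(p_xq-pq_x)\right)dx.$$ Then $\{\mathcal{I}_2,\mathcal{H}\}=0$. This implies that $\mathcal{I}_2$ is invariant in time by the (smooth enough) solutions of the equation, written as the first-order real system $p_t=\phi$, $q_t=\varphi$, $-q_t+\kappa\phi_t=-\beta p_{xx}-\mathrm{Re}\,f(p,q)$, $p_t+\kappa\varphi_t=-\beta q_{xx}-\mathrm{Im}\,f(p,q)$. In complex form, $$\mathcal{I}_2(u,u_t)=\int_{-\infty}^{\infty}\left(-\kappa\,\mathrm{Re}(u_x\overline{u_t})+\frac12\,\mathrm{Im}(u\overline{u_x})\right)dx.$$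 Moreover, $\mathcal{I}_2$ is connected with the symmetry group of this system consisting of spatial translations $$g_\epsilon(p(x),q(x),\phi(x),\varphi(x))=(p(x+\epsilon),q(x+\epsilon),\phi(x+\epsilon),\varphi(x+\epsilon)),\qquad \epsilon\in\mathbb{R},$$ since its infinitesimal generator is $$\frac{d}{d\epsilon}g_\epsilon(p,q,\phi,\varphi)\Big|_{\epsilon=0}=\mathbb{J}(\kappa)\begin{pmatrix}\kappa\phi_x-q_x\\ p_x+\kappa\varphi_x\\ -\kappa p_x\\ -\kappa q_x\end{pmatrix}=\mathbb{J}(\kappa)\,\delta\mathcal{I}_2(p,q,\phi,\varphi).$$
   Context: The structure matrix is $\mathbb{J}(\kappa)=\begin{pmatrix}0&0&-\frac1\kappa&0\\0&0&0&-\frac1\kappa\\\frac1\kappa&0&0&-\frac1{\kappa^2}\\0&\frac1\kappa&\frac1{\kappa^2}&0\end{pmatrix}$. For a functional of $(p,q,\phi,\varphi)$, $\delta=\left(\frac{\delta}{\delta p},\frac{\delta}{\delta q},\frac{\delta}{\delta\phi},\frac{\delta}{\delta\varphi}\right)$ denotes the vector of its variational derivatives. The Poisson bracket of two functionals $F(p,q,\phi,\varphi)$ and $G(p,q,\phi,\varphi)$ is $\{F,G\}=\int_{-\infty}^{\infty}\delta F\,\mathbb{J}(\kappa)\,\delta G\,dx$. The first-order real system is $(p,q,\phi,\varphi)_t^T=\mathbb{J}(\kappa)\,\delta\mathcal{H}(p,q,\phi,\varphi)$. *)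

(* Defs.v *)
From Stdlib Require Export Reals ClassicalEpsilon.
From Coquelicot Require Export Coquelicot.

Open Scope R_scope.

(** * States (p, q, phi, varphi) *)

Record state := mkstate {
  sp : R -> R;
  sq : R -> R;
  sphi : R -> R;
  svarphi : R -> R }.

Definition zero_state : state :=
  mkstate (fun _ => 0) (fun _ => 0) (fun _ => 0) (fun _ => 0).

Definition perturb (U : state) (eps : R) (h : state) : state :=
  mkstate (fun x => sp U x + eps * sp h x)
          (fun x => sq U x + eps * sq h x)
          (fun x => sphi U x + eps * sphi h x)
          (fun x => svarphi U x + eps * svarphi h x).

Definition shift (eps : R) (U : state) : state :=
  mkstate (fun x => sp U (x + eps))
          (fun x => sq U (x + eps))
          (fun x => sphi U (x + eps))
          (fun x => svarphi U (x + eps)).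

Definition col (U : state) (x : R) : @matrix R 4 1 :=
  [ [sp U x], [sq U x], [sphi U x], [svarphi U x] ].

Definition row (U : state) (x : R) : @matrix R 1 4 :=
  [ [sp U x, sq U x, sphi U x, svarphi U x] ].

(** Entrywise derivative of a matrix-valued curve. *)
Definition is_derive_mat {m n : nat} (w : R -> @matrix R m n) (s : R)
    (l : @matrix R m n) : Prop :=
  forall i j : nat, (i < m)%nat -> (j < n)%nat ->
    is_derive (fun r => coeff_mat 0 (w r) i j) s (coeff_mat 0 l i j).

Definition Jmat (kappa : R) : @matrix R 4 4 :=
  [ [0, 0, - (1 / kappa), 0],
    [0, 0, 0, - (1 / kappa)],
    [1 / kappa, 0, 0, - (1 / kappa ^ 2)],
    [0, 1 / kappa, 1 / kappa ^ 2, 0] ].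

(** * Functionals, variational derivatives, Poisson bracket *)

(** Improper Riemann integral; its two endpoints tend to infinity
    independently, so this is not a principal value. *)
Definition Rint (g : R -> R) : R :=
  RInt_gen g (Rbar_locally m_infty) (Rbar_locally p_infty).

Definition ex_Rint (g : R -> R) : Prop :=
  ex_RInt_gen g (Rbar_locally m_infty) (Rbar_locally p_infty).

(** The lower orders are required separately because [ex_derive_n g 2] does
    not imply [ex_derive g]. *)
Definition class_C (n : nat) (g : R -> R) : Prop :=
  (forall (k : nat) (x : R), (k <= n)%nat -> ex_derive_n g k x) /\
  (forall x : R, continuous (Derive_n g n) x).

Definition compact_support (g : R -> R) : Prop :=
  exists M : R, forall x : R, M < Rabs x -> g x = 0.

Definition test_direction (h : state) : Prop :=
  class_C 2 (sp h) /\ class_C 2 (sq h) /\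
  class_C 1 (sphi h) /\ class_C 1 (svarphi h) /\
  compact_support (sp h) /\ compact_support (sq h) /\
  compact_support (sphi h) /\ compact_support (svarphi h).

(** [D] collects (dF/dp, dF/dq, dF/dphi, dF/dvarphi) at [U]. Continuity of [D]
    makes it unique, by the fundamental lemma of the calculus of variations. *)
Definition is_vderiv (F : state -> R) (U D : state) : Prop :=
  class_C 0 (sp D) /\ class_C 0 (sq D) /\
  class_C 0 (sphi D) /\ class_C 0 (svarphi D) /\
  forall h : state, test_direction h ->
    is_derive (fun eps => F (perturb U eps h)) 0
      (Rint (fun x => sp D x * sp h x + sq D x * sq h x
                      + sphi D x * sphi h x + svarphi D x * svarphi h x)).

(** Junk value when [F] has no variational derivative at [U]. *)
Definition vderiv (F : state -> R) (U : state) : state :=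
  epsilon (inhabits zero_state) (is_vderiv F U).

Definition poisson_density (kappa : R) (F G : state -> R) (U : state)
    (x : R) : R :=
  coeff_mat 0
    (Mmult (row (vderiv F U) x) (Mmult (Jmat kappa) (col (vderiv G U) x)))
    0 0.

Definition poisson (kappa : R) (F G : state -> R) (U : state) : R :=
  Rint (poisson_density kappa F G U).

(** * The functionals H and I_2 *)

Definition Ham_density (kappa beta : R) (V : R -> R -> R) (U : state)
    (x : R) : R :=
  beta / 2 * (Derive (sp U) x ^ 2 + Derive (sq U) x ^ 2)
  - V (sp U x) (sq U x)
  - kappa / 2 * (sphi U x ^ 2 + svarphi U x ^ 2).

Definition Ham (kappa beta : R) (V : R -> R -> R) (U : state) : R :=
  Rint (Ham_density kappa beta V U).

Definition I2_density (kappa : R) (U : state) (x : R) : R :=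
  - kappa * (Derive (sp U) x * sphi U x + Derive (sq U) x * svarphi U x)
  + 1 / 2 * (Derive (sp U) x * sq U x - sp U x * Derive (sq U) x).

Definition I2 (kappa : R) (U : state) : R := Rint (I2_density kappa U).

(** Derivative of a complex-valued function of a real variable. *)
Definition Cderive (w : R -> C) (s : R) : C :=
  (Derive (fun r => Re (w r)) s, Derive (fun r => Im (w r)) s).

(** I_2 in complex form, as a function of [u] and [v] = u_t. *)
Definition I2_complex (kappa : R) (u v : R -> C) : R :=
  Rint (fun x => - kappa * Re (Cderive u x * Cconj (v x))%C
                 + 1 / 2 * Im (u x * Cconj (Cderive u x))%C).

(** * The functional space *)

Definition vanishing (g : R -> R) : Prop :=
  is_lim g m_infty 0 /\ is_lim g p_infty 0.

(** States of class C^2 x C^2 x C^1 x C^1, vanishing at infinity together with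
    p_x and q_x, on which both functionals are defined. Convergence of the
    integral of [Ham_density] encodes the normalization of the additive
    constant of [V] (V(0,0) = 0). *)
Definition in_space (kappa beta : R) (V : R -> R -> R) (U : state) : Prop :=
  class_C 2 (sp U) /\ class_C 2 (sq U) /\
  class_C 1 (sphi U) /\ class_C 1 (svarphi U) /\
  vanishing (sp U) /\ vanishing (sq U) /\
  vanishing (Derive (sp U)) /\ vanishing (Derive (sq U)) /\
  vanishing (sphi U) /\ vanishing (svarphi U) /\
  ex_Rint (Ham_density kappa beta V U) /\
  ex_Rint (I2_density kappa U).

Definition smooth_potential (V : R -> R -> R) : Prop :=
  forall (n : nat) (a b : R), ex_diff_n V n a b.

(** * Evolutions t |-> U t on [0, T), with T finite or +infinity *)

(** [w t x]: continuity on [0, T) in the sup norm over x. *)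
Definition sup_continuous (T : Rbar) (w : R -> R -> R) : Prop :=
  forall t0 : R, 0 <= t0 -> Rbar_lt t0 T ->
  forall eps : R, 0 < eps -> exists delta : R, 0 < delta /\
  forall t : R, 0 <= t -> Rbar_lt t T -> Rabs (t - t0) < delta ->
  forall x : R, Rabs (w t x - w t0 x) < eps.

(** Evolutions in the functional space: (p, q) jointly C^2 and (phi, varphi)
    jointly C^1 in (x, t) for 0 < t < T, and p, q, p_x, q_x, phi, varphi in
    C([0, T); C_0). *)
Definition smooth_evolution (kappa beta : R) (V : R -> R -> R) (T : Rbar)
    (U : R -> state) : Prop :=
  (forall t : R, 0 <= t -> Rbar_lt t T -> in_space kappa beta V (U t)) /\
  (forall x t : R, 0 < t -> Rbar_lt t T ->
     ex_diff_n (fun y s => sp (U s) y) 2 x t /\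
     ex_diff_n (fun y s => sq (U s) y) 2 x t /\
     ex_diff_n (fun y s => sphi (U s) y) 1 x t /\
     ex_diff_n (fun y s => svarphi (U s) y) 1 x t) /\
  sup_continuous T (fun t => sp (U t)) /\
  sup_continuous T (fun t => sq (U t)) /\
  sup_continuous T (fun t => Derive (sp (U t))) /\
  sup_continuous T (fun t => Derive (sq (U t))) /\
  sup_continuous T (fun t => sphi (U t)) /\
  sup_continuous T (fun t => svarphi (U t)).

Definition solves_system (kappa beta : R) (f : C -> C) (T : Rbar)
    (U : R -> state) : Prop :=
  forall x t : R, 0 < t -> Rbar_lt t T ->
    Derive (fun s => sp (U s) x) t = sphi (U t) x /\
    Derive (fun s => sq (U s) x) t = svarphi (U t) x /\
    - Derive (fun s => sq (U s) x) t + kappa * Derive (fun s => sphi (U s) x) t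
      = - beta * Derive_n (sp (U t)) 2 x - Re (f (sp (U t) x, sq (U t) x)) /\
    Derive (fun s => sp (U s) x) t + kappa * Derive (fun s => svarphi (U s) x) t
      = - beta * Derive_n (sq (U t)) 2 x - Im (f (sp (U t) x, sq (U t) x)).

(** kappa u_tt + i u_t + beta u_xx + f(u) = 0, for [u x t]. *)
Definition solves_equation (kappa beta : R) (f : C -> C) (T : Rbar)
    (u : R -> R -> C) : Prop :=
  forall x t : R, 0 < t -> Rbar_lt t T ->
    (kappa * Cderive (Cderive (fun s => u x s)) t
     + Ci * Cderive (fun s => u x s) t
     + beta * Cderive (Cderive (fun y => u y t)) x
     + f (u x t))%C = 0.

(* Main.v *)
From Stdlib Require Import Lra Lia FunctionalExtensionality.
Require Import Defs.

(** Write [p, q, phi, psi] for the components of a state, [psi] being [svarphi],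
    and [V_p, V_q] for the partial derivatives of [V].

    Variational derivatives. A compactly supported perturbation changes an
    integral over the line only on a compact interval, where one may
    differentiate under the integral sign and integrate by parts
    ([first_variation]). This gives
<<
      dI_2 = (kappa phi_x - q_x, p_x + kappa psi_x, - kappa p_x, - kappa q_x)
      dH   = (- beta p_xx - V_p, - beta q_xx - V_q, - kappa phi, - kappa psi).
>>
    The value chosen by [vderiv] agrees with these at every point, by the
    fundamental lemma of the calculus of variations
    ([fundamental_lemma_variations], [vderiv_unique]).

    Bracket. Inserting both gradients, the density of the bracket is the
    x-derivative of
<<
      kappa/2 (phi^2 + psi^2) + beta/2 (p_x^2 + q_x^2) + V(p, q),
>>
    which has the same limit V(0, 0) at both ends of the line, so that its
    integral vanishes ([is_Rint_bracket]).

    Invariance in time. Along a solution the density of I_2 satisfies the local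
    conservation law [local_conservation], d_t (density) = d_x (flux), with
<<
      flux = - kappa/2 (phi^2 + psi^2) + beta/2 (p_x^2 + q_x^2) + V(p, q)
             + 1/2 (phi q - p psi).
>>
    The integral I_2 may converge only conditionally, so it is not
    differentiated in time. Instead, the integral over [[a, b]] changes between
    the times 0 and t by t times flux(b) - flux(a), taken at some intermediate
    time (mean value theorem). The components are continuous in time for the
    sup norm and vanish at infinity; by compactness of [[0, t]] they vanish at
    infinity uniformly in time ([uniform_vanishing]), so the flux tends to
    V(0, 0) at both ends uniformly in time, and the change tends to 0 as the
    interval exhausts the line ([I2_invariant]).

    The other assertions are computations: multiplying [dH] and [dI_2] by
    [Jmat] gives the first-order system and the vector (p_x, q_x, phi_x, psi_x),
    which is the derivative of the translations at 0. *)

(** * Improper integrals over the line *)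

Definition is_Rint (g : R -> R) (l : R) : Prop :=
  is_RInt_gen g (Rbar_locally m_infty) (Rbar_locally p_infty) l.

Lemma is_Rint_unique (g : R -> R) (l : R) : is_Rint g l -> Rint g = l.
Proof. exact (is_RInt_gen_unique g l). Qed.

Lemma is_Rint_Rint (g : R -> R) : ex_Rint g -> is_Rint g (Rint g).
Proof. exact (RInt_gen_correct g). Qed.

(** The two endpoints escape to infinity independently, which allows
    intervals [[a, b]] to be chosen freely beyond a threshold. *)
Lemma is_Rint_iff (g : R -> R) (l : R) :
  is_Rint g l <->
  forall eps : R, 0 < eps -> exists M : R, forall a b : R, a < - M -> M < b ->
    exists y : R, is_RInt g a b y /\ Rabs (y - l) < eps.
Proof.
  split.
  - intros H eps Heps.
    destruct (H (fun y => Rabs (y - l) < eps)) as [P Q [A HA] [B HB] HPQ].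
    { exists (mkposreal eps Heps). intros y Hy. exact Hy. }
    exists (Rmax (- A) B). intros a b Ha Hb.
    pose proof (Rmax_l (- A) B). pose proof (Rmax_r (- A) B).
    apply (HPQ a b); [apply HA | apply HB]; lra.
  - intros H P [eps HP].
    destruct (H eps (cond_pos eps)) as [M HM].
    apply (Filter_prod _ _ _ (fun a => a < - M) (fun b => M < b)).
    + exists (- M). auto.
    + exists M. auto.
    + intros a b Ha Hb. destruct (HM a b Ha Hb) as [y [Hy Hl]].
      exists y. split; [exact Hy | apply HP; exact Hl].
Qed.

Lemma ex_RInt_continuous_R (g : R -> R) (a b : R) :
  (forall x, continuous g x) -> ex_RInt g a b.
Proof. intros H. apply (ex_RInt_continuous (V := R_CompleteNormedModule)). auto. Qed.

Lemma is_RInt_zero (g : R -> R) (a b : R) :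
  (forall x, Rmin a b < x < Rmax a b -> g x = 0) -> is_RInt g a b 0.
Proof.
  intros H. apply (is_RInt_ext (fun _ => 0)).
  - intros x Hx. symmetry. auto.
  - pose proof (is_RInt_const a b (0 : R)) as H0.
    unfold scal in H0; simpl in H0; unfold mult in H0; simpl in H0.
    rewrite Rmult_0_r in H0. exact H0.
Qed.

Lemma is_Rint_compact (g : R -> R) (A B : R) : A <= B ->
  (forall x, continuous g x) -> (forall x, x <= A \/ B <= x -> g x = 0) ->
  is_Rint g (RInt g A B).
Proof.
  intros HAB Hc H0. apply is_Rint_iff. intros eps Heps.
  exists (Rmax (- A) B). intros a b Ha Hb.
  pose proof (Rmax_l (- A) B). pose proof (Rmax_r (- A) B).
  exists (RInt g A B). split.
  - replace (RInt g A B) with (plus 0 (plus (RInt g A B) 0)).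
    + apply (is_RInt_Chasles g a A b); [|apply (is_RInt_Chasles g A B b)].
      * apply is_RInt_zero. intros x Hx. apply H0.
        rewrite Rmin_left, Rmax_right in Hx by lra. lra.
      * apply (RInt_correct g). apply ex_RInt_continuous_R; auto.
      * apply is_RInt_zero. intros x Hx. apply H0.
        rewrite Rmin_left, Rmax_right in Hx by lra. lra.
    + unfold plus; simpl. ring.
  - rewrite Rminus_diag, Rabs_R0. exact Heps.
Qed.

Lemma is_Rint_support (g : R -> R) (M : R) : 0 < M ->
  (forall x, continuous g x) -> (forall x, M <= Rabs x -> g x = 0) ->
  is_Rint g (RInt g (- M) M).
Proof.
  intros HM Hc H0. apply is_Rint_compact; auto; [lra|].
  intros x Hx. apply H0. unfold Rabs. destruct (Rcase_abs x); lra.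
Qed.

Lemma is_Rint_ext (f g : R -> R) (l : R) :
  (forall x, f x = g x) -> is_Rint f l -> is_Rint g l.
Proof. intros H. now rewrite (functional_extensionality f g H). Qed.

Lemma Rint_ext (f g : R -> R) : (forall x, f x = g x) -> Rint f = Rint g.
Proof. intros H. now rewrite (functional_extensionality f g H). Qed.

Lemma is_Rint_plus (f g : R -> R) (lf lg : R) :
  is_Rint f lf -> is_Rint g lg -> is_Rint (fun x => f x + g x) (lf + lg).
Proof. exact (is_RInt_gen_plus f g lf lg). Qed.

(** Fundamental theorem of calculus on the whole line: the boundary
    values at the two ends cancel. *)
Lemma is_Rint_derive (F f : R -> R) (l : R) :
  (forall x, is_derive F x (f x)) -> (forall x, continuous f x) ->
  is_lim F m_infty l -> is_lim F p_infty l -> is_Rint f 0.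
Proof.
  intros HF Hf Hm Hp. apply is_Rint_iff. intros eps Heps.
  assert (He : 0 < eps / 2) by lra.
  destruct (Hm (fun y => Rabs (y - l) < eps / 2)) as [A HA].
  { exists (mkposreal _ He). intros y Hy. exact Hy. }
  destruct (Hp (fun y => Rabs (y - l) < eps / 2)) as [B HB].
  { exists (mkposreal _ He). intros y Hy. exact Hy. }
  exists (Rmax (- A) B). intros a b Ha Hb.
  pose proof (Rmax_l (- A) B). pose proof (Rmax_r (- A) B).
  exists (F b - F a). split.
  - apply (is_RInt_derive F f); auto.
  - specialize (HA a ltac:(lra)). specialize (HB b ltac:(lra)).
    apply Rabs_def2 in HA. apply Rabs_def2 in HB. apply Rabs_def1; lra.
Qed.

(** * Continuity of combined functions *)

Lemma continuous_add (f g : R -> R) x :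
  continuous f x -> continuous g x -> continuous (fun y => f y + g y) x.
Proof. intros; now apply (continuous_plus f g). Qed.
Lemma continuous_sub (f g : R -> R) x :
  continuous f x -> continuous g x -> continuous (fun y => f y - g y) x.
Proof. intros; now apply (continuous_minus f g). Qed.
Lemma continuous_mul (f g : R -> R) x :
  continuous f x -> continuous g x -> continuous (fun y => f y * g y) x.
Proof. intros; now apply (continuous_mult f g). Qed.
Lemma continuous_neg (f : R -> R) x :
  continuous f x -> continuous (fun y => - f y) x.
Proof. intros; now apply (continuous_opp f). Qed.
Lemma continuous_power (f : R -> R) n x :
  continuous f x -> continuous (fun y => f y ^ n) x.
Proof.
  intros H. induction n as [|n IH]; simpl.
  - apply continuous_const.
  - apply (continuous_mul f (fun y => f y ^ n)); auto.
Qed.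

Ltac cont :=
  lazymatch goal with
  | |- continuous (fun _ => ?c) _ => apply continuous_const
  | |- continuous (fun y => @?f y + @?g y) _ => apply (continuous_add f g); cont
  | |- continuous (fun y => @?f y - @?g y) _ => apply (continuous_sub f g); cont
  | |- continuous (fun y => @?f y * @?g y) _ => apply (continuous_mul f g); cont
  | |- continuous (fun y => - @?f y) _ => apply (continuous_neg f); cont
  | |- continuous (fun y => @?f y ^ ?n) _ => apply (continuous_power f n); cont
  | _ => auto
  end.

Lemma continuity_2d_pt_swap (f : R -> R -> R) (x y : R) :
  continuity_2d_pt f x y -> continuity_2d_pt (fun u v => f v u) y x.
Proof.
  intros H eps. destruct (H eps) as [d Hd]. exists d. intros u v Hu Hv. auto.
Qed.

Lemma continuity_2d_pt_snd (f : R -> R) (x y : R) :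
  continuous f y -> continuity_2d_pt (fun _ v => f v) x y.
Proof.
  intros H. apply (continuity_1d_2d_pt_comp f (fun _ v => v)).
  - now apply continuity_pt_filterlim.
  - apply continuity_2d_pt_id2.
Qed.

Lemma continuity_2d_pt_comp2 (V f g : R -> R -> R) (x y : R) :
  continuity_2d_pt V (f x y) (g x y) ->
  continuity_2d_pt f x y -> continuity_2d_pt g x y ->
  continuity_2d_pt (fun u v => V (f u v) (g u v)) x y.
Proof.
  intros HV Hf Hg eps. destruct (HV eps) as [d Hd].
  destruct (Hf d) as [d1 H1]. destruct (Hg d) as [d2 H2].
  assert (H0 : 0 < Rmin d1 d2).
  { apply Rmin_case; [apply (cond_pos d1) | apply (cond_pos d2)]. }
  exists (mkposreal _ H0). simpl. intros u v Hu Hv.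
  pose proof (Rmin_l d1 d2). pose proof (Rmin_r d1 d2).
  apply Hd; [apply H1 | apply H2]; lra.
Qed.

Lemma continuity_2d_pt_slice (f : R -> R -> R) (x y : R) :
  continuity_2d_pt f x y -> continuous (f x) y.
Proof.
  intros H. apply continuity_pt_filterlim.
  intros eps Heps. destruct (H (mkposreal eps Heps)) as [d Hd].
  exists d. split; [apply cond_pos|]. intros v [_ Hv].
  apply Hd; [rewrite Rminus_diag, Rabs_R0; apply cond_pos | exact Hv].
Qed.

Ltac cont_2d :=
  lazymatch goal with
  | |- continuity_2d_pt (fun _ _ => ?c) _ _ => apply continuity_2d_pt_const
  | |- continuity_2d_pt (fun u _ => u) _ _ => apply continuity_2d_pt_id1
  | |- continuity_2d_pt (fun u v => @?f u v + @?g u v) _ _ =>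
      apply (continuity_2d_pt_plus f g); cont_2d
  | |- continuity_2d_pt (fun u v => @?f u v - @?g u v) _ _ =>
      apply (continuity_2d_pt_minus f g); cont_2d
  | |- continuity_2d_pt (fun u v => @?f u v * @?g u v) _ _ =>
      apply (continuity_2d_pt_mult f g); cont_2d
  | |- continuity_2d_pt (fun _ v => @?f v) _ _ => apply (continuity_2d_pt_snd f); solve [auto]
  | _ => assumption
  end.

(** * First variation and uniqueness of variational derivatives *)

(** Since [g eps] and [g 0] agree outside [[-M, M]], the derivative falls
    under the integral over that interval. The function [B] collects the boundary
    terms of the integrations by parts that turn the raw first variation [dg 0]
    into [D], the gradient paired with the direction; its values at the two ends
    cancel. *)
Lemma first_variation (g dg : R -> R -> R) (D B : R -> R) (M : R) : 0 < M ->
  ex_Rint (g 0) ->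
  (forall eps x, M <= Rabs x -> g eps x = g 0 x) ->
  (forall eps x, continuous (g eps) x) ->
  (forall eps x, is_derive (fun e => g e x) eps (dg eps x)) ->
  (forall x, continuity_2d_pt dg 0 x) ->
  (forall x, continuous D x) -> (forall x, M <= Rabs x -> D x = 0) ->
  (forall x, is_derive B x (dg 0 x - D x)) -> B (- M) = B M ->
  is_derive (fun eps => Rint (g eps)) 0 (Rint D).
Proof.
  intros HM Hex Hsupp Hc Hd Hdc HDc HD0 HB HBM.
  assert (Hdc0 : forall x, continuous (dg 0) x).
  { intros x. now apply continuity_2d_pt_slice. }
  (* The perturbation only changes the integral over [-M, M]. *)
  apply (is_derive_ext
    (fun eps => Rint (g 0) + RInt (fun x => g eps x - g 0 x) (- M) M)).
  { intros eps. symmetry. apply is_Rint_unique.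
    apply (is_Rint_ext (fun x => g 0 x + (g eps x - g 0 x))); [intros; ring|].
    apply is_Rint_plus; [now apply is_Rint_Rint|].
    apply is_Rint_support; auto.
    - intros x. cont.
    - intros x Hx. rewrite (Hsupp eps x Hx). ring. }
  replace (Rint D) with (0 + RInt (fun x => Derive (fun e => g e x - g 0 x) 0) (- M) M).
  - apply (is_derive_plus (fun _ => Rint (g 0))
      (fun eps => RInt (fun x => g eps x - g 0 x) (- M) M));
      [apply (is_derive_const (Rint (g 0)))|].
    assert (Hd' : forall eps x, is_derive (fun e => g e x - g 0 x) eps (dg eps x)).
    { intros eps x. replace (dg eps x) with (dg eps x - 0) by ring.
      apply (is_derive_minus (fun e => g e x) (fun _ => g 0 x)); auto.
      apply (is_derive_const (g 0 x)). }
    apply (is_derive_RInt_param (fun e x => g e x - g 0 x)).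
    + apply filter_forall. intros e x _. eexists. apply Hd'.
    + intros x _. apply continuity_2d_pt_ext with (2 := Hdc x).
      intros u v. symmetry. apply is_derive_unique. apply Hd'.
    + apply filter_forall. intros e.
      apply (ex_RInt_continuous_R (fun x => g e x - g 0 x)). intros x. cont.
  - rewrite Rplus_0_l. rewrite (is_Rint_unique _ _ (is_Rint_support D M HM HDc HD0)).
    transitivity (RInt (fun x => D x + (dg 0 x - D x)) (- M) M).
    + apply RInt_ext. intros x _. simpl. transitivity (dg 0 x); [|ring].
      apply is_derive_unique. replace (dg 0 x) with (dg 0 x - 0) by ring.
      apply (is_derive_minus (fun e => g e x) (fun _ => g 0 x)); auto.
      apply (is_derive_const (g 0 x)).
    + apply is_RInt_unique. replace (RInt D (- M) M) with (RInt D (- M) M + (B M - B (- M))).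
      * apply (is_RInt_plus D (fun x => dg 0 x - D x)).
        -- apply (RInt_correct D). now apply ex_RInt_continuous_R.
        -- apply (is_RInt_derive B); auto. intros x _. cont.
      * rewrite HBM. ring.
Qed.

Lemma class_C_2_elim (g : R -> R) : class_C 2 g ->
  (forall x, is_derive g x (Derive g x)) /\
  (forall x, is_derive (Derive g) x (Derive_n g 2 x)) /\
  (forall x, continuous (Derive_n g 2) x).
Proof.
  intros [H1 H2]. split; [|split]; auto; intros x.
  - apply Derive_correct. exact (H1 1%nat x ltac:(lia)).
  - apply (Derive_correct (Derive g)). exact (H1 2%nat x ltac:(lia)).
Qed.

Lemma class_C_1_elim (g : R -> R) : class_C 1 g ->
  (forall x, is_derive g x (Derive g x)) /\ (forall x, continuous (Derive g) x).
Proof.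
  intros [H1 H2]. split; auto; intros x.
  apply Derive_correct. exact (H1 1%nat x ltac:(lia)).
Qed.

Lemma class_C_2_intro (g g1 g2 : R -> R) :
  (forall x, is_derive g x (g1 x)) -> (forall x, is_derive g1 x (g2 x)) ->
  (forall x, continuous g2 x) -> class_C 2 g.
Proof.
  intros H1 H2 H3.
  assert (E1 : Derive g = g1).
  { apply functional_extensionality. intros x. now apply is_derive_unique. }
  assert (E2 : Derive_n g 2 = g2).
  { apply functional_extensionality. intros x.
    change (Derive (Derive g) x = g2 x). rewrite E1. now apply is_derive_unique. }
  split.
  - intros [|[|[|k]]] x Hk; [exact I| | |lia].
    + exists (g1 x). apply H1.
    + change (ex_derive (Derive g) x). rewrite E1. exists (g2 x). apply H2.
  - rewrite E2. exact H3.
Qed.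

Lemma is_derive_continuous (g : R -> R) (x l : R) : is_derive g x l -> continuous g x.
Proof. intros H. apply (ex_derive_continuous g). now exists l. Qed.

Lemma class_C_2_1 (g : R -> R) : class_C 2 g -> class_C 1 g.
Proof.
  intros H. destruct (class_C_2_elim g H) as [_ [H2 _]]. destruct H as [H1 _]. split.
  - intros k x Hk. apply H1. lia.
  - intros x. exact (is_derive_continuous _ _ _ (H2 x)).
Qed.

Lemma class_C_zero (n : nat) : class_C n (fun _ => 0).
Proof.
  split.
  - intros k x _. apply ex_derive_n_const.
  - intros x. apply continuous_ext with (fun _ => 0); [|apply continuous_const].
    intros y. destruct n as [|n]; [reflexivity|]. symmetry. apply Derive_n_const.
Qed.

(** At 0 the increment of the power is at most quadratic, which joins the
    zero branch to the polynomial branch. This provides C^2 bump functions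
    without exponentials. *)
Lemma is_derive_pos_part_pow (n : nat) (y : R) :
  is_derive (fun z => Rmax 0 z ^ S (S n)) y (INR (S (S n)) * Rmax 0 y ^ S n).
Proof.
  destruct (Rtotal_order y 0) as [Hy|[->|Hy]].
  - rewrite Rmax_left by lra. rewrite pow_i by lia. rewrite Rmult_0_r.
    apply is_derive_ext_loc with (fun _ => 0); [|apply (is_derive_const (0 : R))].
    assert (Hy' : 0 < - y) by lra.
    exists (mkposreal _ Hy'). intros z Hz. apply Rabs_def2 in Hz. simpl in Hz.
    unfold minus, plus, opp in Hz; simpl in Hz.
    rewrite Rmax_left by lra. now rewrite pow_i by lia.
  - rewrite Rmax_left by lra. rewrite pow_i by lia. rewrite Rmult_0_r.
    apply is_derive_Reals. intros eps Heps.
    assert (Hd : 0 < Rmin eps 1) by (apply Rmin_case; lra).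
    exists (mkposreal _ Hd). simpl. intros h Hh Hhd.
    pose proof (Rmin_l eps 1). pose proof (Rmin_r eps 1).
    rewrite (Rmax_left 0 0) by lra. rewrite Rplus_0_l, Rmult_0_l, !Rminus_0_r.
    destruct (Rle_lt_dec h 0) as [Hle|Hlt].
    + rewrite Rmax_left by lra. rewrite Rmult_0_l.
      unfold Rdiv. rewrite Rmult_0_l, Rabs_R0. exact Heps.
    + rewrite Rmax_right by lra.
      replace (h * (h * h ^ n) / h) with (h * h ^ n) by (field; lra).
      apply Rabs_def2 in Hhd.
      assert (Hp : 0 <= h ^ n <= 1).
      { split; [apply pow_le; lra|]. rewrite <- (pow1 n). apply pow_incr. lra. }
      rewrite Rabs_right by (apply Rle_ge, Rmult_le_pos; lra).
      apply Rle_lt_trans with (h * 1); [apply Rmult_le_compat_l; lra | lra].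
  - rewrite Rmax_right by lra.
    apply is_derive_ext_loc with (fun z => z ^ S (S n)).
    + exists (mkposreal _ Hy). intros z Hz. apply Rabs_def2 in Hz. simpl in Hz.
      unfold minus, plus, opp in Hz; simpl in Hz.
      now rewrite Rmax_right by lra.
    + auto_derive; auto. simpl. ring.
Qed.

Definition bump (x0 r x : R) : R := Rmax 0 (r ^ 2 - (x - x0) ^ 2) ^ 3.

Lemma continuous_pos_part (f : R -> R) (x : R) :
  continuous f x -> continuous (fun y => Rmax 0 (f y)) x.
Proof.
  intros H. apply continuous_ext with (fun y => (f y + Rabs (f y)) * / 2).
  - intros y. unfold Rmax, Rabs. destruct (Rle_dec 0 (f y)), (Rcase_abs (f y)); lra.
  - cont. apply (continuous_comp f Rabs); auto.
    apply continuous_Rabs.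
Qed.

Lemma bump_class_C (x0 r c : R) : class_C 2 (fun x => c * bump x0 r x).
Proof.
  pose (w := fun x => r ^ 2 - (x - x0) ^ 2).
  assert (Hw : forall x, is_derive w x (-2 * (x - x0))).
  { intros x. unfold w. auto_derive; auto. ring. }
  assert (Hp : forall n x, is_derive (fun y => Rmax 0 (w y) ^ S (S n)) x
                 (-2 * (x - x0) * (INR (S (S n)) * Rmax 0 (w x) ^ S n))).
  { intros n x. apply (is_derive_comp (fun z => Rmax 0 z ^ S (S n)) w); auto.
    apply is_derive_pos_part_pow. }
  apply (class_C_2_intro _
    (fun x => c * (-2 * (x - x0) * (INR 3 * Rmax 0 (w x) ^ 2)))
    (fun x => c * (-2 * (INR 3 * Rmax 0 (w x) ^ 2)
                   + -2 * (x - x0) * (INR 3 * (-2 * (x - x0) * (INR 2 * Rmax 0 (w x) ^ 1)))))).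
  - intros x. apply (is_derive_scal (fun x => bump x0 r x)). apply (Hp 1%nat x).
  - intros x.
    apply (is_derive_scal (fun x => -2 * (x - x0) * (INR 3 * Rmax 0 (w x) ^ 2))).
    apply (is_derive_mult (fun x => -2 * (x - x0)) (fun x => INR 3 * Rmax 0 (w x) ^ 2)).
    + auto_derive; auto. ring.
    + apply (is_derive_scal (fun x => Rmax 0 (w x) ^ 2)). apply (Hp 0%nat x).
    + intros; apply Rmult_comm.
  - intros x. assert (Hc : continuous (fun x => Rmax 0 (w x)) x).
    { apply continuous_pos_part. exact (is_derive_continuous _ _ _ (Hw x)). }
    pose proof (continuous_id x : continuous (fun y : R => y) x). cont.
Qed.

(** Where [d] and [d'] differ, their difference keeps a constant sign on an
    interval; a bump supported there, multiplied by the value of the difference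
    at the centre, is a test function whose integral against the difference is
    positive. *)
Lemma fundamental_lemma_variations (d d' : R -> R) :
  (forall x, continuous d x) -> (forall x, continuous d' x) ->
  (forall h, class_C 2 h -> compact_support h ->
     Rint (fun x => d x * h x) = Rint (fun x => d' x * h x)) ->
  forall x, d x = d' x.
Proof.
  intros Hd Hd' H x0.
  destruct (Req_dec (d x0) (d' x0)) as [E|NE]; [exact E|exfalso].
  (* the factor c makes the integrand positive whatever the sign of d - d' *)
  pose (c := d x0 - d' x0).
  assert (Hc : 0 < Rabs c) by (apply Rabs_pos_lt; unfold c; lra).
  assert (Hdd : continuous (fun x => d x - d' x) x0) by cont.
  apply continuity_pt_filterlim in Hdd.
  destruct (Hdd (Rabs c) Hc) as [r [Hr Hnear]].
  assert (Hpos : forall x, Rabs (x - x0) < r -> 0 < (d x - d' x) * c).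
  { intros x Hx. destruct (Req_dec x x0) as [->|Hxx].
    - fold c. pose proof (Rsqr_pos_lt c). unfold Rsqr in H0. apply H0.
      unfold c. lra.
    - assert (Hn : Rabs (d x - d' x - c) < Rabs c).
      { apply (Hnear x). split; [|exact Hx]. split; [exact I|auto]. }
      revert Hn. generalize (d x - d' x). intros y. unfold Rabs.
      destruct (Rcase_abs (y - c)), (Rcase_abs c); intros; nra. }
  pose (h := fun x => c * bump x0 r x).
  assert (Hh : class_C 2 h) by apply bump_class_C.
  assert (Hhc : forall x, continuous h x).
  { intros x. exact (is_derive_continuous _ _ _ (proj1 (class_C_2_elim h Hh) x)). }
  assert (Hout : forall x, x <= x0 - r \/ x0 + r <= x -> h x = 0).
  { intros x Hx. unfold h, bump. rewrite Rmax_left by nra. ring. }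
  assert (Hcs : compact_support h).
  { exists (Rabs x0 + r). intros x Hx. apply Hout. revert Hx.
    unfold Rabs. destruct (Rcase_abs x), (Rcase_abs x0); lra. }
  assert (Hint : forall e, (forall x, continuous e x) ->
            is_Rint (fun x => e x * h x) (RInt (fun x => e x * h x) (x0 - r) (x0 + r))).
  { intros e He. apply is_Rint_compact; [lra| |].
    - intros x. cont.
    - intros x Hx. rewrite Hout by auto. ring. }
  pose proof (H h Hh Hcs) as E.
  rewrite (is_Rint_unique _ _ (Hint d Hd)), (is_Rint_unique _ _ (Hint d' Hd')) in E.
  assert (P : 0 < RInt (fun x => d x * h x - d' x * h x) (x0 - r) (x0 + r)).
  { apply RInt_gt_0; [lra| |].
    - intros x Hx. unfold h.
      replace (d x * (c * bump x0 r x) - d' x * (c * bump x0 r x))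
        with ((d x - d' x) * c * bump x0 r x) by ring.
      apply Rmult_lt_0_compat; [apply Hpos; apply Rabs_def1; lra|].
      unfold bump. apply pow_lt. rewrite Rmax_right by nra. nra.
    - intros x _. cont. }
  rewrite (is_RInt_unique _ _ _ _ (is_RInt_minus (fun x => d x * h x) (fun x => d' x * h x)
     _ _ _ _ (RInt_correct _ _ _ (ex_RInt_continuous_R (fun x => d x * h x) _ _ ltac:(intros; cont)))
      (RInt_correct _ _ _ (ex_RInt_continuous_R (fun x => d' x * h x) _ _ ltac:(intros; cont))))) in P.
  unfold minus, plus, opp in P; simpl in P. rewrite E in P. lra.
Qed.

(** Testing with directions that have a single nonzero component reduces the
    claim to one scalar fundamental lemma per component. *)
Lemma vderiv_unique (F : state -> R) (U D D' : state) (x : R) :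
  is_vderiv F U D -> is_vderiv F U D' ->
  sp D x = sp D' x /\ sq D x = sq D' x /\ sphi D x = sphi D' x /\ svarphi D x = svarphi D' x.
Proof.
  intros (C1 & C2 & C3 & C4 & H) (C1' & C2' & C3' & C4' & H').
  assert (E : forall h, test_direction h ->
    Rint (fun x => sp D x * sp h x + sq D x * sq h x
                      + sphi D x * sphi h x + svarphi D x * svarphi h x) =
    Rint (fun x => sp D' x * sp h x + sq D' x * sq h x
                      + sphi D' x * sphi h x + svarphi D' x * svarphi h x)).
  { intros h Hh. rewrite <- (is_derive_unique _ _ _ (H h Hh)).
    apply is_derive_unique. now apply H'. }
  assert (Z : compact_support (fun _ => 0)) by (exists 0; auto).
  pose proof (class_C_zero 1) as Z1. pose proof (class_C_zero 2) as Z2.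
  split; [|split; [|split]].
  - apply (fundamental_lemma_variations (sp D) (sp D')); [apply C1|apply C1'|].
    intros h Hh Hs.
    assert (Th : test_direction (mkstate h (fun _ => 0) (fun _ => 0) (fun _ => 0)))
      by (unfold test_direction; simpl; tauto).
    etransitivity; [|etransitivity; [exact (E _ Th)|]];
      apply Rint_ext; intros y; simpl; ring.
  - apply (fundamental_lemma_variations (sq D) (sq D')); [apply C2|apply C2'|].
    intros h Hh Hs.
    assert (Th : test_direction (mkstate (fun _ => 0) h (fun _ => 0) (fun _ => 0)))
      by (unfold test_direction; simpl; tauto).
    etransitivity; [|etransitivity; [exact (E _ Th)|]];
      apply Rint_ext; intros y; simpl; ring.
  - apply (fundamental_lemma_variations (sphi D) (sphi D')); [apply C3|apply C3'|].
    intros h Hh%class_C_2_1 Hs.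
    assert (Th : test_direction (mkstate (fun _ => 0) (fun _ => 0) h (fun _ => 0)))
      by (unfold test_direction; simpl; tauto).
    etransitivity; [|etransitivity; [exact (E _ Th)|]];
      apply Rint_ext; intros y; simpl; ring.
  - apply (fundamental_lemma_variations (svarphi D) (svarphi D')); [apply C4|apply C4'|].
    intros h Hh%class_C_2_1 Hs.
    assert (Th : test_direction (mkstate (fun _ => 0) (fun _ => 0) (fun _ => 0) h))
      by (unfold test_direction; simpl; tauto).
    etransitivity; [|etransitivity; [exact (E _ Th)|]];
      apply Rint_ext; intros y; simpl; ring.
Qed.

Lemma vderiv_spec (F : state -> R) (U D : state) :
  is_vderiv F U D -> is_vderiv F U (vderiv F U).
Proof. intros H. unfold vderiv. apply epsilon_spec. now exists D. Qed.

(** * The variational derivatives of I_2 and H *)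

Lemma Derive_outside_support (g : R -> R) (M x : R) :
  (forall y, M < Rabs y -> g y = 0) -> M < Rabs x -> Derive g x = 0.
Proof.
  intros H Hx. transitivity (Derive (fun _ => 0) x); [|apply Derive_const].
  apply Derive_ext_loc.
  assert (He : 0 < Rabs x - M) by lra.
  exists (mkposreal _ He). intros y Hy. apply H.
  assert (Hy' : Rabs (y - x) < Rabs x - M) by exact Hy.
  pose proof (Rabs_triang_inv x y) as T. rewrite Rabs_minus_sym in T. lra.
Qed.

Lemma test_direction_support (h : state) : test_direction h ->
  exists M : R, 0 < M /\ forall x, M <= Rabs x ->
    sp h x = 0 /\ sq h x = 0 /\ sphi h x = 0 /\ svarphi h x = 0 /\
    Derive (sp h) x = 0 /\ Derive (sq h) x = 0.
Proof.
  intros (_ & _ & _ & _ & [M1 H1] & [M2 H2] & [M3 H3] & [M4 H4]).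
  (* strictly beyond each of the four bounds, where derivatives vanish as well *)
  exists (Rabs M1 + Rabs M2 + Rabs M3 + Rabs M4 + 1).
  pose proof (Rle_abs M1). pose proof (Rle_abs M2).
  pose proof (Rle_abs M3). pose proof (Rle_abs M4).
  pose proof (Rabs_pos M1). pose proof (Rabs_pos M2).
  pose proof (Rabs_pos M3). pose proof (Rabs_pos M4).
  split; [lra|]. intros x Hx.
  split; [apply H1; lra|]. split; [apply H2; lra|].
  split; [apply H3; lra|]. split; [apply H4; lra|].
  split; [apply (Derive_outside_support _ M1) | apply (Derive_outside_support _ M2)]; auto; lra.
Qed.

Definition Vp (V : R -> R -> R) (a b : R) : R := Derive (fun z => V z b) a.
Definition Vq (V : R -> R -> R) (a b : R) : R := Derive (fun z => V a z) b.

Lemma smooth_potential_continuity (V : R -> R -> R) (a b : R) : smooth_potential V ->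
  continuity_2d_pt V a b /\ continuity_2d_pt (Vp V) a b /\ continuity_2d_pt (Vq V) a b.
Proof.
  intros H. destruct (H 1%nat a b) as (H0 & _ & _ & [H1 _] & [H2 _]). auto.
Qed.

(** Existence of partial derivatives alone gives no chain rule; continuity of
    [Vp] near the point makes [V] differentiable there. *)
Lemma is_derive_potential (V : R -> R -> R) (f g : R -> R) (x df dg : R) :
  smooth_potential V -> is_derive f x df -> is_derive g x dg ->
  is_derive (fun y => V (f y) (g y)) x (Vp V (f x) (g x) * df + Vq V (f x) (g x) * dg).
Proof.
  intros HV Hf Hg. apply is_derive_Reals. apply derivable_pt_lim_comp_2d.
  - apply filterdiff_differentiable_pt_lim.
    apply (is_derive_filterdiff V _ _ (Vp V)).
    + apply filter_forall. intros [a b]. simpl. apply Derive_correct.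
      apply (HV 1%nat a b).
    + apply (Derive_correct (fun z => V (f x) z)). apply (HV 1%nat (f x) (g x)).
    + apply continuity_2d_pt_filterlim. now apply smooth_potential_continuity.
  - now apply is_derive_Reals.
  - now apply is_derive_Reals.
Qed.

Lemma continuous_comp2 (W : R -> R -> R) (f g : R -> R) (x : R) :
  continuity_2d_pt W (f x) (g x) -> continuous f x -> continuous g x ->
  continuous (fun y => W (f y) (g y)) x.
Proof.
  intros HW Hf Hg. apply (continuous_comp_2 f g W); auto.
  now apply continuity_2d_pt_filterlim.
Qed.

Lemma Derive_perturb (f g : R -> R) (e x : R) :
  (forall x, is_derive f x (Derive f x)) -> (forall x, is_derive g x (Derive g x)) ->
  Derive (fun y => f y + e * g y) x = Derive f x + e * Derive g x.
Proof.
  intros Hf Hg. apply is_derive_unique.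
  apply (is_derive_plus f (fun y => e * g y)); auto. apply (is_derive_scal g); auto.
Qed.

Definition grad_I2 (kappa : R) (U : state) : state :=
  mkstate (fun x => kappa * Derive (sphi U) x - Derive (sq U) x)
          (fun x => Derive (sp U) x + kappa * Derive (svarphi U) x)
          (fun x => - kappa * Derive (sp U) x)
          (fun x => - kappa * Derive (sq U) x).

Definition grad_Ham (kappa beta : R) (V : R -> R -> R) (U : state) : state :=
  mkstate (fun x => - beta * Derive_n (sp U) 2 x - Vp V (sp U x) (sq U x))
          (fun x => - beta * Derive_n (sq U) 2 x - Vq V (sp U x) (sq U x))
          (fun x => - kappa * sphi U x)
          (fun x => - kappa * svarphi U x).

Lemma class_C_0_intro (g : R -> R) : (forall x, continuous g x) -> class_C 0 g.
Proof.
  intros H. split; [|exact H]. intros [|k] x Hk; [exact I|lia].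
Qed.

(** The differentiability and continuity facts contained in membership of
    C^2 x C^2 x C^1 x C^1, shared by states and test directions. *)
Record regular (U : state) : Prop := {
  reg_p : forall x, is_derive (sp U) x (Derive (sp U) x);
  reg_q : forall x, is_derive (sq U) x (Derive (sq U) x);
  reg_dp : forall x, is_derive (Derive (sp U)) x (Derive_n (sp U) 2 x);
  reg_dq : forall x, is_derive (Derive (sq U)) x (Derive_n (sq U) 2 x);
  reg_phi : forall x, is_derive (sphi U) x (Derive (sphi U) x);
  reg_vphi : forall x, is_derive (svarphi U) x (Derive (svarphi U) x);
  reg_p_cont : forall x, continuous (sp U) x;
  reg_q_cont : forall x, continuous (sq U) x;
  reg_dp_cont : forall x, continuous (Derive (sp U)) x;
  reg_dq_cont : forall x, continuous (Derive (sq U)) x;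
  reg_ddp_cont : forall x, continuous (Derive_n (sp U) 2) x;
  reg_ddq_cont : forall x, continuous (Derive_n (sq U) 2) x;
  reg_phi_cont : forall x, continuous (sphi U) x;
  reg_vphi_cont : forall x, continuous (svarphi U) x;
  reg_dphi_cont : forall x, continuous (Derive (sphi U)) x;
  reg_dvphi_cont : forall x, continuous (Derive (svarphi U)) x }.

Lemma class_C_regular (U : state) :
  class_C 2 (sp U) -> class_C 2 (sq U) -> class_C 1 (sphi U) -> class_C 1 (svarphi U) ->
  regular U.
Proof.
  intros Hp Hq Hf Hg.
  destruct (class_C_2_elim _ Hp) as (P1 & P2 & P3).
  destruct (class_C_2_elim _ Hq) as (Q1 & Q2 & Q3).
  destruct (class_C_1_elim _ Hf) as (F1 & F2).
  destruct (class_C_1_elim _ Hg) as (G1 & G2).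
  constructor; auto; intros x; eapply is_derive_continuous; eauto.
Qed.

Lemma in_space_regular (kappa beta : R) (V : R -> R -> R) (U : state) :
  in_space kappa beta V U -> regular U.
Proof. intros (H1 & H2 & H3 & H4 & _). now apply class_C_regular. Qed.

Lemma test_direction_regular (h : state) : test_direction h -> regular h.
Proof. intros (H1 & H2 & H3 & H4 & _). now apply class_C_regular. Qed.

(** [auto_derive] produces derivatives of eta-expanded functions, which [ring]
    would treat as new atoms. *)
Ltac eta_reduce f := change (fun y : R => f y) with f.

(** The boundary term of the integrations by parts is
    - kappa (a phi + b psi) + 1/2 (a q - p b), for a direction (a, b, c, d). *)
Lemma is_vderiv_I2 (kappa : R) (U : state) :
  regular U -> ex_Rint (I2_density kappa U) ->
  is_vderiv (I2 kappa) U (grad_I2 kappa U).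
Proof.
  intros HU Hex. destruct HU.
  split; [|split; [|split; [|split]]]; try (apply class_C_0_intro; intros x; simpl; cont).
  intros h Hh. destruct (test_direction_support h Hh) as (M & HM & Hsupp).
  destruct (test_direction_regular h Hh) as [a1 b1 _ _ c1 d1 ac bc dac dbc _ _ cc dc _ _].
  destruct U as [p q f v]. destruct h as [a b c d]. simpl in *.
  pose (g := fun e x =>
    - kappa * ((Derive p x + e * Derive a x) * (f x + e * c x)
               + (Derive q x + e * Derive b x) * (v x + e * d x))
    + 1 / 2 * ((Derive p x + e * Derive a x) * (q x + e * b x)
               - (p x + e * a x) * (Derive q x + e * Derive b x))).
  pose (dg := fun e x =>
    - kappa * (Derive a x * (f x + e * c x) + (Derive p x + e * Derive a x) * c x
               + Derive b x * (v x + e * d x) + (Derive q x + e * Derive b x) * d x)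
    + 1 / 2 * (Derive a x * (q x + e * b x) + (Derive p x + e * Derive a x) * b x
               - a x * (Derive q x + e * Derive b x) - (p x + e * a x) * Derive b x)).
  apply (is_derive_ext (fun e => Rint (g e))).
  { intros e. apply Rint_ext. intros x. unfold I2_density, perturb; simpl.
    rewrite !Derive_perturb by auto. reflexivity. }
  apply (first_variation g dg _
    (fun x => - kappa * (a x * f x + b x * v x) + 1 / 2 * (a x * q x - p x * b x)) M);
    auto.
  - replace (g 0) with (I2_density kappa (mkstate p q f v)); auto.
    apply functional_extensionality. intros x. unfold I2_density, g; simpl. ring.
  - intros e x Hx. 
    unfold g. destruct (Hsupp x Hx) as (E1 & E2 & E3 & E4 & E5 & E6).
    rewrite E1, E2, E3, E4, E5, E6. ring.
  - intros e x. unfold g. cont.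
  - intros e x. unfold g, dg. auto_derive; auto. ring.
  - intros x. unfold dg. cont_2d.
  - intros x. cont.
  - intros x Hx. destruct (Hsupp x Hx) as (E1 & E2 & E3 & E4 & _).
    rewrite E1, E2, E3, E4. ring.
  - intros x. unfold dg. auto_derive.
    + repeat split; eexists; eauto.
    + eta_reduce a. eta_reduce b. eta_reduce f. eta_reduce v. eta_reduce p. eta_reduce q. field.
  - destruct (Hsupp M) as (E1 & E2 & _); [rewrite Rabs_right; lra|].
    destruct (Hsupp (- M)) as (E3 & E4 & _); [rewrite Rabs_Ropp, Rabs_right; lra|].
    rewrite E1, E2, E3, E4. ring.
Qed.

(** Only the gradient terms need an integration by parts; the boundary term is
    beta (p_x a + q_x b), for a direction (a, b, c, d). *)
Lemma is_vderiv_Ham (kappa beta : R) (V : R -> R -> R) (U : state) :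
  smooth_potential V -> regular U -> ex_Rint (Ham_density kappa beta V U) ->
  is_vderiv (Ham kappa beta V) U (grad_Ham kappa beta V U).
Proof.
  intros HV HU Hex. destruct HU.
  assert (HVc := fun a b => smooth_potential_continuity V a b HV).
  assert (Vpc : forall x, continuous (fun y => Vp V (sp U y) (sq U y)) x).
  { intros x. apply continuous_comp2; auto. apply HVc. }
  assert (Vqc : forall x, continuous (fun y => Vq V (sp U y) (sq U y)) x).
  { intros x. apply continuous_comp2; auto. apply HVc. }
  split; [|split; [|split; [|split]]]; try (apply class_C_0_intro; intros x; simpl; cont).
  intros h Hh. destruct (test_direction_support h Hh) as (M & HM & Hsupp).
  destruct (test_direction_regular h Hh) as [a1 b1 _ _ c1 d1 ac bc dac dbc _ _ cc dc _ _].
  destruct U as [p q f v]. destruct h as [a b c d]. simpl in *.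
  pose (g := fun e x =>
    beta / 2 * ((Derive p x + e * Derive a x) ^ 2 + (Derive q x + e * Derive b x) ^ 2)
    - V (p x + e * a x) (q x + e * b x)
    - kappa / 2 * ((f x + e * c x) ^ 2 + (v x + e * d x) ^ 2)).
  pose (dg := fun e x =>
    beta * ((Derive p x + e * Derive a x) * Derive a x
            + (Derive q x + e * Derive b x) * Derive b x)
    - (Vp V (p x + e * a x) (q x + e * b x) * a x
       + Vq V (p x + e * a x) (q x + e * b x) * b x)
    - kappa * ((f x + e * c x) * c x + (v x + e * d x) * d x)).
  apply (is_derive_ext (fun e => Rint (g e))).
  { intros e. apply Rint_ext. intros x. unfold Ham_density, perturb; simpl.
    rewrite !Derive_perturb by auto. reflexivity. }
  apply (first_variation g dg _ (fun x => beta * (Derive p x * a x + Derive q x * b x)) M);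
    auto.
  - replace (g 0) with (Ham_density kappa beta V (mkstate p q f v)); auto.
    apply functional_extensionality. intros x. unfold Ham_density, g; simpl.
    rewrite !Rmult_0_l, !Rplus_0_r. reflexivity.
  - intros e x Hx.
    unfold g. destruct (Hsupp x Hx) as (E1 & E2 & E3 & E4 & E5 & E6).
    rewrite E1, E2, E3, E4, E5, E6, !Rmult_0_r. ring.
  - intros e x. unfold g.
    assert (continuous (fun y => V (p y + e * a y) (q y + e * b y)) x).
    { apply (continuous_comp2 V (fun y => p y + e * a y) (fun y => q y + e * b y));
        [apply HVc | cont | cont]. }
    cont.
  - intros e x. unfold g, dg.
    assert (HVe := is_derive_potential V (fun e => p x + e * a x) (fun e => q x + e * b x)
              e (a x) (b x) HV ltac:(auto_derive; auto; ring) ltac:(auto_derive; auto; ring)).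
    simpl in HVe.
    apply (is_derive_minus
      (fun e => beta / 2 * ((Derive p x + e * Derive a x) ^ 2 + (Derive q x + e * Derive b x) ^ 2)
        - V (p x + e * a x) (q x + e * b x))
      (fun e => kappa / 2 * ((f x + e * c x) ^ 2 + (v x + e * d x) ^ 2))).
    + apply (is_derive_minus
      (fun e => beta / 2 * ((Derive p x + e * Derive a x) ^ 2 + (Derive q x + e * Derive b x) ^ 2))
      (fun e => V (p x + e * a x) (q x + e * b x))); [|exact HVe].
      auto_derive; auto. field.
    + auto_derive; auto. field.
  - intros x. unfold dg.
    assert (continuity_2d_pt (fun e y => Vp V (p y + e * a y) (q y + e * b y)) 0 x).
    { apply (continuity_2d_pt_comp2 (Vp V)); [apply HVc | cont_2d | cont_2d]. }
    assert (continuity_2d_pt (fun e y => Vq V (p y + e * a y) (q y + e * b y)) 0 x).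
    { apply (continuity_2d_pt_comp2 (Vq V)); [apply HVc | cont_2d | cont_2d]. }
    cont_2d.
  - intros x. cont.
  - intros x Hx. destruct (Hsupp x Hx) as (E1 & E2 & E3 & E4 & _).
    rewrite E1, E2, E3, E4. ring.
  - intros x. unfold dg. rewrite !Rmult_0_l, !Rplus_0_r.
    auto_derive.
    + repeat split; eexists; eauto.
    + change (Derive_n p 2 x) with (Derive (Derive p) x).
      change (Derive_n q 2 x) with (Derive (Derive q) x).
      eta_reduce a. eta_reduce b. eta_reduce p. eta_reduce q.
      eta_reduce (Derive p). eta_reduce (Derive q). ring.
  - destruct (Hsupp M) as (E1 & E2 & _); [rewrite Rabs_right; lra|].
    destruct (Hsupp (- M)) as (E3 & E4 & _); [rewrite Rabs_Ropp, Rabs_right; lra|].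
    rewrite E1, E2, E3, E4. ring.
Qed.

Lemma vderiv_I2 (kappa beta : R) (V : R -> R -> R) (U : state) :
  in_space kappa beta V U ->
  is_vderiv (I2 kappa) U (vderiv (I2 kappa) U) /\
  forall x, col (vderiv (I2 kappa) U) x = col (grad_I2 kappa U) x /\
            row (vderiv (I2 kappa) U) x = row (grad_I2 kappa U) x.
Proof.
  intros HU. assert (HD : is_vderiv (I2 kappa) U (grad_I2 kappa U)).
  { apply is_vderiv_I2; [exact (in_space_regular _ _ _ _ HU) | apply HU]. }
  pose proof (vderiv_spec _ _ _ HD) as HS. split; [exact HS|]. intros x.
  destruct (vderiv_unique _ _ _ _ x HS HD) as (E1 & E2 & E3 & E4).
  unfold col, row. now rewrite E1, E2, E3, E4.
Qed.

Lemma vderiv_Ham (kappa beta : R) (V : R -> R -> R) (U : state) :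
  smooth_potential V -> in_space kappa beta V U ->
  is_vderiv (Ham kappa beta V) U (vderiv (Ham kappa beta V) U) /\
  forall x, col (vderiv (Ham kappa beta V) U) x = col (grad_Ham kappa beta V U) x.
Proof.
  intros HV HU. assert (HD : is_vderiv (Ham kappa beta V) U (grad_Ham kappa beta V U)).
  { apply is_vderiv_Ham; [exact HV | exact (in_space_regular _ _ _ _ HU) | apply HU]. }
  pose proof (vderiv_spec _ _ _ HD) as HS. split; [exact HS|]. intros x.
  destruct (vderiv_unique _ _ _ _ x HS HD) as (E1 & E2 & E3 & E4).
  unfold col. now rewrite E1, E2, E3, E4.
Qed.

(** * The Poisson bracket *)

(** Matrices are nested pairs; naming the column shape keeps them out of the way
    of rewriting. *)
Definition col4 (a b c d : R) : @matrix R 4 1 := [ [a], [b], [c], [d] ].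

Lemma col4_ext (a b c d a' b' c' d' : R) :
  a = a' -> b = b' -> c = c' -> d = d' -> col4 a b c d = col4 a' b' c' d'.
Proof. now intros -> -> -> ->. Qed.

Lemma Jmat_col4 (kappa a b c d : R) :
  Mmult (Jmat kappa) (col4 a b c d) =
  col4 (- (1 / kappa) * c) (- (1 / kappa) * d)
       (1 / kappa * a - 1 / kappa ^ 2 * d) (1 / kappa * b + 1 / kappa ^ 2 * c).
Proof.
  unfold Mmult, Jmat, mk_matrix. simpl. rewrite !sum_Sn, !sum_O.
  unfold coeff_mat, coeff_Tn; simpl. unfold plus, mult; simpl.
  apply col4_ext; ring.
Qed.

Lemma row_col4 (U : state) (x a b c d : R) :
  coeff_mat 0 (Mmult (row U x) (col4 a b c d)) 0 0
  = sp U x * a + sq U x * b + sphi U x * c + svarphi U x * d.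
Proof.
  unfold Mmult, mk_matrix. simpl. rewrite !sum_Sn, !sum_O.
  unfold coeff_mat, coeff_Tn; simpl. unfold plus, mult; simpl. ring.
Qed.

Lemma is_derive_mat_col4 (a b c d : R -> R) (s a' b' c' d' : R) :
  is_derive_mat (fun r => col4 (a r) (b r) (c r) (d r)) s (col4 a' b' c' d') <->
  is_derive a s a' /\ is_derive b s b' /\ is_derive c s c' /\ is_derive d s d'.
Proof.
  split.
  - intros H. split; [|split; [|split]].
    + exact (H 0%nat 0%nat ltac:(lia) ltac:(lia)).
    + exact (H 1%nat 0%nat ltac:(lia) ltac:(lia)).
    + exact (H 2%nat 0%nat ltac:(lia) ltac:(lia)).
    + exact (H 3%nat 0%nat ltac:(lia) ltac:(lia)).
  - intros (Ha & Hb & Hc & Hd) [|[|[|[|i]]]] [|j] Hi Hj; try lia; assumption.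
Qed.

(** The bracket of I_2 and H is the integral of the derivative of this function
    for alpha = kappa/2, gamma = 0, and the flux of the density of I_2 along
    solutions is this function for alpha = - kappa/2, gamma = 1/2. *)
Definition flux (alpha beta gamma : R) (V : R -> R -> R) (U : state) (x : R) : R :=
  alpha * (sphi U x ^ 2 + svarphi U x ^ 2)
  + beta / 2 * (Derive (sp U) x ^ 2 + Derive (sq U) x ^ 2)
  + V (sp U x) (sq U x)
  + gamma * (sphi U x * sq U x - sp U x * svarphi U x).

Definition dflux (alpha beta gamma : R) (V : R -> R -> R) (U : state) (x : R) : R :=
  2 * alpha * (sphi U x * Derive (sphi U) x + svarphi U x * Derive (svarphi U) x)
  + beta * (Derive (sp U) x * Derive_n (sp U) 2 x + Derive (sq U) x * Derive_n (sq U) 2 x)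
  + (Vp V (sp U x) (sq U x) * Derive (sp U) x + Vq V (sp U x) (sq U x) * Derive (sq U) x)
  + gamma * (Derive (sphi U) x * sq U x + sphi U x * Derive (sq U) x
             - Derive (sp U) x * svarphi U x - sp U x * Derive (svarphi U) x).

Lemma is_derive_flux (alpha beta gamma : R) (V : R -> R -> R) (U : state) (x : R) :
  smooth_potential V -> regular U ->
  is_derive (flux alpha beta gamma V U) x (dflux alpha beta gamma V U x).
Proof.
  intros HV []. unfold flux, dflux.
  apply (is_derive_plus
    (fun x => alpha * (sphi U x ^ 2 + svarphi U x ^ 2)
      + beta / 2 * (Derive (sp U) x ^ 2 + Derive (sq U) x ^ 2) + V (sp U x) (sq U x))
    (fun x => gamma * (sphi U x * sq U x - sp U x * svarphi U x))).
  - apply (is_derive_plus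
      (fun x => alpha * (sphi U x ^ 2 + svarphi U x ^ 2)
        + beta / 2 * (Derive (sp U) x ^ 2 + Derive (sq U) x ^ 2))
      (fun x => V (sp U x) (sq U x))).
    + destruct U as [p q f v]; simpl in *.
      auto_derive.
      * repeat split; eexists; eauto.
      * change (Derive_n p 2 x) with (Derive (Derive p) x).
        change (Derive_n q 2 x) with (Derive (Derive q) x).
        eta_reduce f. eta_reduce v. eta_reduce p. eta_reduce q.
        eta_reduce (Derive p). eta_reduce (Derive q). field.
    + apply is_derive_potential; auto.
  - destruct U as [p q f v]; simpl in *.
    auto_derive.
    * repeat split; eexists; eauto.
    * eta_reduce f. eta_reduce v. eta_reduce p. eta_reduce q. ring.
Qed.

Lemma continuous_dflux (alpha beta gamma : R) (V : R -> R -> R) (U : state) (x : R) :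
  smooth_potential V -> regular U -> continuous (dflux alpha beta gamma V U) x.
Proof.
  intros HV []. unfold dflux.
  assert (continuous (fun y => Vp V (sp U y) (sq U y)) x).
  { apply continuous_comp2; auto. now apply smooth_potential_continuity. }
  assert (continuous (fun y => Vq V (sp U y) (sq U y)) x).
  { apply continuous_comp2; auto. now apply smooth_potential_continuity. }
  cont.
Qed.

(** The filter [F] is left general because the limit is needed both at an end of
    the line for a fixed state, and at infinity in space uniformly in time. *)
Lemma filterlim_flux {T : Type} (F : (T -> Prop) -> Prop) {FF : Filter F}
  (alpha beta gamma : R) (V : R -> R -> R) (U : T -> state) (y : T -> R) :
  smooth_potential V ->
  filterlim (fun z => sp (U z) (y z)) F (locally 0) ->
  filterlim (fun z => sq (U z) (y z)) F (locally 0) ->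
  filterlim (fun z => Derive (sp (U z)) (y z)) F (locally 0) ->
  filterlim (fun z => Derive (sq (U z)) (y z)) F (locally 0) ->
  filterlim (fun z => sphi (U z) (y z)) F (locally 0) ->
  filterlim (fun z => svarphi (U z) (y z)) F (locally 0) ->
  filterlim (fun z => flux alpha beta gamma V (U z) (y z)) F (locally (V 0 0)).
Proof.
  intros HV Hp Hq Hdp Hdq Hf Hv.
  assert (Hadd : forall (f g : T -> R) (a b : R), filterlim f F (locally a) ->
    filterlim g F (locally b) -> filterlim (fun z => f z + g z) F (locally (a + b))).
  { intros f g a b H1 H2. apply (filterlim_comp_2 f g Rplus H1 H2).
    apply (filterlim_plus (V := R_NormedModule) a b). }
  assert (Hmul : forall (f g : T -> R) (a b : R), filterlim f F (locally a) ->
    filterlim g F (locally b) -> filterlim (fun z => f z * g z) F (locally (a * b))).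
  { intros f g a b H1 H2. apply (filterlim_comp_2 f g Rmult H1 H2).
    apply (filterlim_mult (K := R_AbsRing) a b). }
  assert (Hc : forall c : R, filterlim (fun _ : T => c) F (locally c)).
  { intros c. apply filterlim_const. }
  assert (HV0 : filterlim (fun z => V (sp (U z) (y z)) (sq (U z) (y z))) F (locally (V 0 0))).
  { apply (filterlim_comp_2 _ _ V Hp Hq).
    destruct (smooth_potential_continuity V 0 0 HV) as [H0 _].
    apply continuity_2d_pt_filterlim in H0.
    intros P HP. specialize (H0 P HP). destruct H0 as [e He].
    apply (Filter_prod _ _ _ (ball 0 e) (ball 0 e)); try (exists e; auto).
    intros a b Ha Hb. apply (He (a, b)). split; assumption. }
  unfold flux.
  replace (V 0 0) with (alpha * (0 * 0 + 0 * 0) + beta / 2 * (0 * 0 + 0 * 0) + V 0 0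
                        + gamma * (0 * 0 + -1 * (0 * 0))) by ring.
  apply (filterlim_ext (fun z =>
    alpha * (sphi (U z) (y z) * sphi (U z) (y z) + svarphi (U z) (y z) * svarphi (U z) (y z))
    + beta / 2 * (Derive (sp (U z)) (y z) * Derive (sp (U z)) (y z)
                  + Derive (sq (U z)) (y z) * Derive (sq (U z)) (y z))
    + V (sp (U z) (y z)) (sq (U z) (y z))
    + gamma * (sphi (U z) (y z) * sq (U z) (y z)
               + -1 * (sp (U z) (y z) * svarphi (U z) (y z))))).
  { intros z. ring. }
  repeat first [assumption | apply Hc | apply Hadd | apply Hmul].
Qed.

(** The products p_x psi and q_x phi cancel between the entries of the two
    gradients coupled by [Jmat], and what remains is an exact derivative. *)
Lemma is_Rint_bracket (kappa beta : R) (V : R -> R -> R) (U : state) :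
  0 < kappa -> smooth_potential V -> in_space kappa beta V U ->
  is_Rint (poisson_density kappa (I2 kappa) (Ham kappa beta V) U) 0.
Proof.
  intros Hk HV HU.
  pose proof (in_space_regular _ _ _ _ HU) as HR.
  apply (is_Rint_ext (dflux (kappa / 2) beta 0 V U)).
  { intros x. unfold poisson_density.
    rewrite (proj2 (proj2 (vderiv_I2 _ _ _ _ HU) x)).
    rewrite (proj2 (vderiv_Ham _ _ _ _ HV HU) x).
    etransitivity; [|symmetry; etransitivity; [|apply row_col4]].
    2: { do 2 f_equal. apply (Jmat_col4 kappa). }
    unfold dflux, grad_I2, grad_Ham; cbn [sp sq sphi svarphi]. field. lra. }
  destruct HU as (_ & _ & _ & _ & [] & [] & [] & [] & [] & [] & _).
  apply (is_Rint_derive (flux (kappa / 2) beta 0 V U) _ (V 0 0)).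
  - intros x. now apply is_derive_flux.
  - intros x. now apply continuous_dflux.
  - apply (filterlim_flux (Rbar_locally' m_infty) _ _ _ V (fun _ => U) (fun x => x)); auto.
  - apply (filterlim_flux (Rbar_locally' p_infty) _ _ _ V (fun _ => U) (fun x => x)); auto.
Qed.

(** * The equation, the first-order system and its Hamiltonian form *)

(** The equations hold at neighbouring times too, which is what differentiating
    them once more in time requires. *)
Lemma locally_time (T : Rbar) (t : R) : 0 < t -> Rbar_lt t T ->
  locally t (fun s => 0 < s /\ Rbar_lt s T).
Proof.
  intros H0 HT. apply filter_and.
  - now apply (open_gt 0).
  - now apply (open_Rbar_lt T).
Qed.

Lemma complex_equation (kappa beta a1 a2 b1 b2 c1 c2 : R) (z : C) :
  (kappa * (a1, a2) + Ci * (b1, b2) + beta * (c1, c2) + z)%C = RtoC 0 <->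
  kappa * a1 - b2 + beta * c1 + Re z = 0 /\ kappa * a2 + b1 + beta * c2 + Im z = 0.
Proof.
  destruct z as [z1 z2].
  unfold Cmult, Cplus, Ci, RtoC; simpl.
  split.
  - intros E. injection E as E1 E2. split; lra.
  - intros [E1 E2]. f_equal; lra.
Qed.

(** The first two equations hold on a whole interval of times, so u_tt may be
    replaced by (phi_t, psi_t); the remaining equations are the real and imaginary
    parts of the complex one. *)
Lemma system_complex (kappa beta : R) (f : C -> C) (T : Rbar) (U : R -> state) :
  solves_system kappa beta f T U <->
    (forall x t : R, 0 < t -> Rbar_lt t T ->
       Cderive (fun s => (sp (U s) x, sq (U s) x)) t = (sphi (U t) x, svarphi (U t) x)) /\
    solves_equation kappa beta f T (fun x t => (sp (U t) x, sq (U t) x)).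
Proof.
  assert (Htt : forall x t (w : state -> R -> R) (w' : state -> R -> R), 0 < t -> Rbar_lt t T ->
     (forall s, 0 < s -> Rbar_lt s T -> Derive (fun r => w (U r) x) s = w' (U s) x) ->
     Derive (fun s => Derive (fun r => w (U r) x) s) t = Derive (fun s => w' (U s) x) t).
  { intros x t w w' H0 HT H. apply Derive_ext_loc.
    generalize (locally_time T t H0 HT). apply filter_imp. intros s [Hs0 HsT]. auto. }
  split.
  - intros H. split.
    + intros x t H0 HT. destruct (H x t H0 HT) as (E1 & E2 & _).
      exact (f_equal2 pair E1 E2).
    + intros x t H0 HT. destruct (H x t H0 HT) as (E1 & E2 & E3 & E4).
      apply complex_equation. simpl.
      pose proof (Htt x t sp sphi H0 HT (fun s h0 hT => proj1 (H x s h0 hT))) as P2.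
      pose proof (Htt x t sq svarphi H0 HT (fun s h0 hT => proj1 (proj2 (H x s h0 hT)))) as Q2.
      rewrite P2, Q2.
      change (Derive (fun r => Derive (fun r0 => sp (U t) r0) r) x)
        with (Derive_n (sp (U t)) 2 x).
      change (Derive (fun r => Derive (fun r0 => sq (U t) r0) r) x)
        with (Derive_n (sq (U t)) 2 x).
      unfold Re, Im in *. lra.
  - intros [Hu He].
    assert (H1 : forall x t, 0 < t -> Rbar_lt t T ->
      Derive (fun s => sp (U s) x) t = sphi (U t) x /\
      Derive (fun s => sq (U s) x) t = svarphi (U t) x).
    { intros x t H0 HT. specialize (Hu x t H0 HT). injection Hu as E1 E2. auto. }
    intros x t H0 HT. destruct (H1 x t H0 HT) as [E1 E2].
    pose proof (He x t H0 HT) as E. apply complex_equation in E. simpl in E.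
    pose proof (Htt x t sp sphi H0 HT (fun s h0 hT => proj1 (H1 x s h0 hT))) as P2.
    pose proof (Htt x t sq svarphi H0 HT (fun s h0 hT => proj2 (H1 x s h0 hT))) as Q2.
    rewrite P2, Q2 in E.
    change (Derive (fun r => Derive (fun r0 => sp (U t) r0) r) x)
        with (Derive_n (sp (U t)) 2 x) in E.
    change (Derive (fun r => Derive (fun r0 => sq (U t) r0) r) x)
        with (Derive_n (sq (U t)) 2 x) in E.
    unfold Re, Im in *. split; [exact E1|split; [exact E2|]]. lra.
Qed.

Lemma evolution_ex_derive (kappa beta : R) (V : R -> R -> R) (T : Rbar) (U : R -> state)
  (x t : R) : smooth_evolution kappa beta V T U -> 0 < t -> Rbar_lt t T ->
  ex_derive (fun s => sp (U s) x) t /\ ex_derive (fun s => sq (U s) x) t /\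
  ex_derive (fun s => sphi (U s) x) t /\ ex_derive (fun s => svarphi (U s) x) t.
Proof.
  intros (_ & H & _) H0 HT.
  destruct (H x t H0 HT) as ((_ & _ & P & _) & (_ & _ & Q & _) & (_ & _ & F & _) & (_ & _ & G & _)).
  auto.
Qed.

Lemma is_derive_iff (g : R -> R) (x l : R) :
  ex_derive g x -> (is_derive g x l <-> Derive g x = l).
Proof.
  intros H. split.
  - apply is_derive_unique.
  - intros <-. now apply Derive_correct.
Qed.

(** The first two rows of [Jmat] give p_t = phi and q_t = psi; the last two give
    the remaining equations, divided by kappa, with q_t and p_t replaced by psi
    and phi. *)
Lemma system_Hamiltonian (kappa beta : R) (V : R -> R -> R) (f : C -> C) (T : Rbar)
  (U : R -> state) : 0 < kappa -> smooth_potential V ->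
  (forall p q : R, Re (f (p, q)) = Vp V p q) ->
  (forall p q : R, Im (f (p, q)) = Vq V p q) ->
  smooth_evolution kappa beta V T U ->
  (solves_system kappa beta f T U <->
     forall x t : R, 0 < t -> Rbar_lt t T ->
       is_derive_mat (fun s => col (U s) x) t
         (Mmult (Jmat kappa) (col (vderiv (Ham kappa beta V) (U t)) x))).
Proof.
  intros Hk HV Hre Him HU.
  assert (Hpt : forall x t, 0 < t -> Rbar_lt t T ->
    (is_derive_mat (fun s => col (U s) x) t
         (Mmult (Jmat kappa) (col (vderiv (Ham kappa beta V) (U t)) x)) <->
     Derive (fun s => sp (U s) x) t = sphi (U t) x /\
     Derive (fun s => sq (U s) x) t = svarphi (U t) x /\
     kappa * Derive (fun s => sphi (U s) x) t =
       - beta * Derive_n (sp (U t)) 2 x - Vp V (sp (U t) x) (sq (U t) x) + svarphi (U t) x /\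
     kappa * Derive (fun s => svarphi (U s) x) t =
       - beta * Derive_n (sq (U t)) 2 x - Vq V (sp (U t) x) (sq (U t) x) - sphi (U t) x)).
  { intros x t H0 HT.
    assert (HUt : in_space kappa beta V (U t)) by (apply HU; auto; lra).
    destruct (evolution_ex_derive _ _ _ _ _ x t HU H0 HT) as (P & Q & F & G).
    rewrite (proj2 (vderiv_Ham _ _ _ _ HV HUt) x).
    change (col (grad_Ham kappa beta V (U t)) x) with
      (col4 (- beta * Derive_n (sp (U t)) 2 x - Vp V (sp (U t) x) (sq (U t) x))
            (- beta * Derive_n (sq (U t)) 2 x - Vq V (sp (U t) x) (sq (U t) x))
            (- kappa * sphi (U t) x) (- kappa * svarphi (U t) x)).
    rewrite Jmat_col4.
    etransitivity; [apply (is_derive_mat_col4 (fun s => sp (U s) x) (fun s => sq (U s) x)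
       (fun s => sphi (U s) x) (fun s => svarphi (U s) x))|].
    rewrite !is_derive_iff by assumption.
    assert (E : forall a b : R, a = b / kappa <-> kappa * a = b).
    { intros a b. split; [intros -> | intros <-]; field; lra. }
    rewrite <- !E.
    replace (- (1 / kappa) * (- kappa * sphi (U t) x)) with (sphi (U t) x) by (field; lra).
    replace (- (1 / kappa) * (- kappa * svarphi (U t) x)) with (svarphi (U t) x) by (field; lra).
    match goal with |- (_ /\ _ /\ _ = ?a /\ _ = ?b) <-> (_ /\ _ /\ _ = ?c /\ _ = ?d) =>
      replace a with c by (field; lra); replace b with d by (field; lra) end.
    reflexivity. }
  split; intros H x t H0 HT.
  - apply Hpt; auto. destruct (H x t H0 HT) as (E1 & E2 & E3 & E4).
    rewrite Hre in E3. rewrite Him in E4. repeat split; lra.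
  - specialize (H x t H0 HT). apply Hpt in H; auto. destruct H as (E1 & E2 & E3 & E4).
    rewrite Hre, Him. repeat split; lra.
Qed.

(** * Complex form and spatial translations *)

Lemma I2_complex_form (kappa : R) (U : state) :
  I2 kappa U = I2_complex kappa (fun x => (sp U x, sq U x)) (fun x => (sphi U x, svarphi U x)).
Proof.
  apply Rint_ext. intros x. unfold I2_density, Cderive, Cmult, Cconj, Re, Im; simpl.
  eta_reduce (sp U). eta_reduce (sq U). ring.
Qed.

Lemma Derive_shift (g : R -> R) (e x : R) : Derive (fun y => g (y + e)) x = Derive g (x + e).
Proof. exact (Derive_n_comp_trans g 1 x e). Qed.

Lemma class_C_shift (n : nat) (g : R -> R) (e : R) :
  class_C n g -> class_C n (fun y => g (y + e)).
Proof.
  intros [H1 H2]. split.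
  - intros k x Hk. apply ex_derive_n_comp_trans. auto.
  - intros x. apply continuous_ext with (fun y => Derive_n g n (y + e)).
    + intros y. symmetry. apply Derive_n_comp_trans.
    + apply (continuous_comp (fun y => y + e) (Derive_n g n)); [|apply H2].
      apply continuous_add; [apply continuous_id | apply continuous_const].
Qed.

Lemma vanishing_shift (g : R -> R) (e : R) : vanishing g -> vanishing (fun y => g (y + e)).
Proof.
  intros [Hm Hp]. split; intros P HP.
  - destruct (Hm P HP) as [M HM]. exists (M - e). intros x Hx. apply HM. lra.
  - destruct (Hp P HP) as [M HM]. exists (M - e). intros x Hx. apply HM. lra.
Qed.

Lemma ex_Rint_shift (g : R -> R) (e : R) : ex_Rint g -> ex_Rint (fun y => g (y + e)).
Proof.
  intros [l Hl]. exists l. apply is_Rint_iff. intros eps Heps.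
  destruct (proj1 (is_Rint_iff g l) Hl eps Heps) as [M HM].
  exists (M + Rabs e). pose proof (Rle_abs e). pose proof (Rle_abs (- e)).
  rewrite Rabs_Ropp in H0. intros a b Ha Hb.
  destruct (HM (a + e) (b + e)) as [y [Hy Hyl]]; [lra|lra|].
  exists y. split; [|exact Hyl].
  apply (is_RInt_ext (fun x => scal 1 (g (1 * x + e)))).
  - intros x _. transitivity (g (1 * x + e)); [exact (Rmult_1_l _) | now rewrite Rmult_1_l].
  - apply (is_RInt_comp_lin g 1 e). now rewrite !Rmult_1_l.
Qed.

Lemma vanishing_ext (f g : R -> R) : (forall x, f x = g x) -> vanishing f -> vanishing g.
Proof. intros H. now rewrite (functional_extensionality f g H). Qed.

Lemma ex_Rint_ext (f g : R -> R) : (forall x, f x = g x) -> ex_Rint f -> ex_Rint g.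
Proof. intros H. now rewrite (functional_extensionality f g H). Qed.

Lemma in_space_shift (kappa beta : R) (V : R -> R -> R) (e : R) (U : state) :
  in_space kappa beta V U -> in_space kappa beta V (shift e U).
Proof.
  intros (H1 & H2 & H3 & H4 & H5 & H6 & H7 & H8 & H9 & H10 & H11 & H12).
  unfold in_space, shift; simpl.
  do 4 (split; [now apply class_C_shift|]).
  do 2 (split; [now apply vanishing_shift|]).
  do 2 (split; [eapply vanishing_ext; [intros x; symmetry; apply Derive_shift|];
                now apply vanishing_shift|]).
  do 2 (split; [now apply vanishing_shift|]).
  split.
  - apply (ex_Rint_ext (fun y => Ham_density kappa beta V U (y + e))).
    + intros x. unfold Ham_density; simpl. now rewrite !Derive_shift.
    + now apply ex_Rint_shift.
  - apply (ex_Rint_ext (fun y => I2_density kappa U (y + e))).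
    + intros x. unfold I2_density; simpl. now rewrite !Derive_shift.
    + now apply ex_Rint_shift.
Qed.

Lemma ex_diff_n_shift (n : nat) (e : R) : forall (f : R -> R -> R) (x y : R),
  ex_diff_n f n (x + e) y -> ex_diff_n (fun u v => f (u + e) v) n x y.
Proof.
  assert (Hc : forall (f : R -> R -> R) x y, continuity_2d_pt f (x + e) y ->
    continuity_2d_pt (fun u v => f (u + e) v) x y).
  { intros f x y H eps. destruct (H eps) as [d Hd]. exists d. intros u v Hu Hv.
    apply Hd; auto. now replace (u + e - (x + e)) with (u - x) by ring. }
  induction n as [|n IH]; intros f x y H; simpl in *.
  - split; [apply Hc; apply H | exact I].
  - destruct H as (H0 & H1 & H2 & H3 & H4). split; [now apply Hc|]. split.
    { exact (ex_derive_n_comp_trans (fun z => f z y) 1 x e H1). }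
    split; [exact H2|]. split.
    + apply ex_diff_n_ext_loc with (2 := IH _ _ _ H3).
      apply locally_2d_forall. intros u v. symmetry.
      apply (Derive_shift (fun z => f z v)).
    + exact (IH _ _ _ H4).
Qed.

Lemma sup_continuous_shift (T : Rbar) (w : R -> R -> R) (e : R) :
  sup_continuous T w -> sup_continuous T (fun t x => w t (x + e)).
Proof.
  intros H t0 H0 HT eps Heps. destruct (H t0 H0 HT eps Heps) as [d [Hd Hw]].
  exists d. auto.
Qed.

Lemma sup_continuous_ext (T : Rbar) (w w' : R -> R -> R) :
  (forall t x, w t x = w' t x) -> sup_continuous T w -> sup_continuous T w'.
Proof.
  intros E H t0 H0 HT eps Heps. destruct (H t0 H0 HT eps Heps) as [d [Hd Hw]].
  exists d. split; [exact Hd|]. intros. rewrite <- !E. auto.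
Qed.

Lemma smooth_evolution_shift (kappa beta : R) (V : R -> R -> R) (T : Rbar) (e : R)
  (U : R -> state) : smooth_evolution kappa beta V T U ->
  smooth_evolution kappa beta V T (fun t => shift e (U t)).
Proof.
  intros (H1 & H2 & H3 & H4 & H5 & H6 & H7 & H8).
  split; [|split].
  - intros t H0 HT. apply in_space_shift. auto.
  - intros x t H0 HT. destruct (H2 (x + e) t H0 HT) as (P & Q & F & G). simpl.
    split; [|split; [|split]].
    + exact (ex_diff_n_shift 2 e (fun y s => sp (U s) y) x t P).
    + exact (ex_diff_n_shift 2 e (fun y s => sq (U s) y) x t Q).
    + exact (ex_diff_n_shift 1 e (fun y s => sphi (U s) y) x t F).
    + exact (ex_diff_n_shift 1 e (fun y s => svarphi (U s) y) x t G).
  - split; [exact (sup_continuous_shift T _ e H3)|].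
    split; [exact (sup_continuous_shift T _ e H4)|].
    split; [|split; [|split]].
    + refine (sup_continuous_ext T _ _ _ (sup_continuous_shift T _ e H5)).
      intros t x. symmetry. apply Derive_shift.
    + refine (sup_continuous_ext T _ _ _ (sup_continuous_shift T _ e H6)).
      intros t x. symmetry. apply Derive_shift.
    + exact (sup_continuous_shift T _ e H7).
    + exact (sup_continuous_shift T _ e H8).
Qed.

Lemma solves_system_shift (kappa beta : R) (f : C -> C) (T : Rbar) (e : R)
  (U : R -> state) : solves_system kappa beta f T U ->
  solves_system kappa beta f T (fun t => shift e (U t)).
Proof.
  intros H x t H0 HT. unfold shift; cbn [sp sq sphi svarphi].
  rewrite !Derive_n_comp_trans. exact (H (x + e) t H0 HT).
Qed.

(** Multiplying dI_2 by [Jmat] gives (p_x, q_x, phi_x, psi_x). *)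
Lemma shift_generator (kappa : R) (U : state) (x : R) : 0 < kappa -> regular U ->
  is_derive_mat (fun eps => col (shift eps U) x) 0
    (Mmult (Jmat kappa) (col (grad_I2 kappa U) x)).
Proof.
  intros Hk HU. destruct HU.
  change (col (grad_I2 kappa U) x) with
    (col4 (kappa * Derive (sphi U) x - Derive (sq U) x)
          (Derive (sp U) x + kappa * Derive (svarphi U) x)
          (- kappa * Derive (sp U) x) (- kappa * Derive (sq U) x)).
  rewrite Jmat_col4.
  assert (Hs : forall (g : R -> R) (l : R), is_derive g x l -> is_derive (fun e => g (x + e)) 0 l).
  { intros g l Hg. replace l with (1 * l) by ring.
    apply (is_derive_comp g (fun e => x + e)).
    - now rewrite Rplus_0_r.
    - auto_derive; auto. }
  apply (is_derive_mat_col4 (fun e => sp U (x + e)) (fun e => sq U (x + e))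
    (fun e => sphi U (x + e)) (fun e => svarphi U (x + e))).
  split; [|split; [|split]]; apply Hs.
  - replace (- (1 / kappa) * (- kappa * Derive (sp U) x)) with (Derive (sp U) x)
      by (field; lra). auto.
  - replace (- (1 / kappa) * (- kappa * Derive (sq U) x)) with (Derive (sq U) x)
      by (field; lra). auto.
  - match goal with |- is_derive _ _ ?a => replace a with (Derive (sphi U) x) by (field; lra) end.
    auto.
  - match goal with |- is_derive _ _ ?a => replace a with (Derive (svarphi U) x) by (field; lra) end.
    auto.
Qed.

(** * Invariance of I_2 in time *)

(** Projection onto [[0, t1]]. Composing with it turns an evolution on [[0, t1]]
    into one defined for all times, so that one-sided continuity at the end times
    becomes ordinary continuity. *)
Definition clamp (t1 s : R) : R := Rmax 0 (Rmin s t1).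

Lemma clamp_range (t1 s : R) : 0 <= t1 -> 0 <= clamp t1 s <= t1.
Proof.
  intros H. unfold clamp, Rmax, Rmin.
  destruct (Rle_dec s t1); destruct (Rle_dec 0 _); lra.
Qed.

Lemma clamp_id (t1 s : R) : 0 <= s <= t1 -> clamp t1 s = s.
Proof. intros H. unfold clamp. rewrite Rmin_left, Rmax_right; lra. Qed.

Lemma clamp_lipschitz (t1 s s0 : R) : Rabs (clamp t1 s - clamp t1 s0) <= Rabs (s - s0).
Proof.
  unfold clamp, Rmax, Rmin.
  destruct (Rle_dec s t1), (Rle_dec s0 t1); repeat destruct (Rle_dec 0 _);
    unfold Rabs; repeat destruct (Rcase_abs _); lra.
Qed.

Lemma Rbar_le_time (T : Rbar) (t t1 : R) : t <= t1 -> Rbar_lt t1 T -> Rbar_lt t T.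
Proof. intros H1 H2. exact (Rbar_le_lt_trans t t1 T H1 H2). Qed.

Lemma sup_continuous_joint (T : Rbar) (w : R -> R -> R) (t1 s x : R) :
  sup_continuous T w ->
  (forall t, 0 <= t -> Rbar_lt t T -> forall y, continuous (w t) y) ->
  0 <= t1 -> Rbar_lt t1 T ->
  continuity_2d_pt (fun r y => w (clamp t1 r) y) s x.
Proof.
  intros Hw Hc H0 HT eps.
  assert (Hr : forall r, 0 <= clamp t1 r /\ Rbar_lt (clamp t1 r) T).
  { intros r. destruct (clamp_range t1 r H0). split; [lra|].
    now apply (Rbar_le_time T _ t1). }
  destruct (Hr s) as [Hs HsT].
  assert (He : 0 < eps / 2) by (pose proof (cond_pos eps); lra).
  destruct (Hw _ Hs HsT _ He) as [d [Hd Hwd]].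
  pose proof (Hc _ Hs HsT x) as Hx. apply continuity_pt_filterlim in Hx.
  destruct (proj1 (continuity_pt_locally _ _) Hx (mkposreal _ He)) as [d' Hd'].
  assert (Hm : 0 < Rmin d d') by (apply Rmin_case; [lra | apply cond_pos]).
  exists (mkposreal _ Hm). simpl. intros r y Hr' Hy.
  pose proof (Rmin_l d d'). pose proof (Rmin_r d d').
  replace (w (clamp t1 r) y - w (clamp t1 s) x)
    with ((w (clamp t1 r) y - w (clamp t1 s) y) + (w (clamp t1 s) y - w (clamp t1 s) x)) by ring.
  apply Rle_lt_trans with (1 := Rabs_triang _ _).
  assert (Htime : Rabs (w (clamp t1 r) y - w (clamp t1 s) y) < eps / 2).
  { apply Hwd; try apply Hr.
    apply Rle_lt_trans with (1 := clamp_lipschitz t1 r s). lra. }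
  assert (Hspace : Rabs (w (clamp t1 s) y - w (clamp t1 s) x) < eps / 2).
  { apply (Hd' y). apply Rlt_le_trans with (1 := Hy). lra. }
  lra.
Qed.

(** For each time t choose one radius [delta t] that serves both as a radius of
    sup-norm continuity around t and, through its inverse, as a spatial threshold
    beyond which [w t] is small. A positive lower bound for finitely many such
    radii whose balls cover [[0, t1]] then yields a common spatial threshold. *)
Lemma uniform_vanishing (T : Rbar) (w : R -> R -> R) (t1 eps : R) :
  sup_continuous T w ->
  (forall t, 0 <= t -> Rbar_lt t T -> vanishing (w t)) ->
  0 <= t1 -> Rbar_lt t1 T -> 0 < eps ->
  exists M : R, forall s x, 0 <= s <= t1 -> M < Rabs x -> Rabs (w s x) < eps.
Proof.
  intros Hw Hv H0 HT Heps.
  assert (He : 0 < eps / 2) by lra.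
  assert (Hloc : forall t, exists d : posreal, 0 <= t <= t1 ->
    (forall s, 0 <= s <= t1 -> Rabs (s - t) < d -> forall x, Rabs (w s x - w t x) < eps / 2) /\
    (forall x, / d < Rabs x -> Rabs (w t x) < eps / 2)).
  { intros t. destruct (Rle_dec 0 t) as [Ht0|]; [|exists (mkposreal 1 Rlt_0_1); lra].
    destruct (Rle_dec t t1) as [Ht1|]; [|exists (mkposreal 1 Rlt_0_1); lra].
    assert (HtT := Rbar_le_time T t t1 Ht1 HT).
    destruct (Hw t Ht0 HtT _ He) as [d [Hd Hwd]].
    assert (Hball : locally 0 (fun y : R => Rabs y < eps / 2)).
    { exists (mkposreal _ He). intros y Hy.
      assert (Hy' : Rabs (y - 0) < eps / 2) by exact Hy. now rewrite Rminus_0_r in Hy'. }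
    destruct (Hv t Ht0 HtT) as [Lm Lp].
    destruct (Lm _ Hball) as [A HA]. destruct (Lp _ Hball) as [B HB].
    pose proof (Rabs_pos A). pose proof (Rabs_pos B).
    assert (Hpos : 0 < / (Rabs A + Rabs B + 1)) by (apply Rinv_0_lt_compat; lra).
    assert (Hm : 0 < Rmin d (/ (Rabs A + Rabs B + 1))) by (apply Rmin_case; lra).
    (* beyond 1/radius one is past both thresholds A and B *)
    exists (mkposreal _ Hm). intros _. simpl. split.
    - intros s Hs Hst x. apply Hwd; [lra | now apply (Rbar_le_time T s t1) |].
      pose proof (Rmin_l d (/ (Rabs A + Rabs B + 1))). lra.
    - intros x Hx.
      assert (Hbig : Rabs A + Rabs B + 1 < Rabs x).
      { apply Rle_lt_trans with (2 := Hx).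
        pose proof (Rinv_le_contravar _ _ Hm (Rmin_r d _)) as Hinv.
        now rewrite Rinv_inv in Hinv. }
      pose proof (Rle_abs B). pose proof (Rle_abs (- A)). rewrite Rabs_Ropp in *.
      revert Hbig. unfold Rabs at 3. destruct (Rcase_abs x); intros Hbig.
      + apply HA. lra.
      + apply HB. lra. }
  pose (delta := fun t => proj1_sig (constructive_indefinite_description _ (Hloc t))).
  assert (Hdelta : forall t, 0 <= t <= t1 ->
    (forall s, 0 <= s <= t1 -> Rabs (s - t) < delta t ->
       forall x, Rabs (w s x - w t x) < eps / 2) /\
    (forall x, / delta t < Rabs x -> Rabs (w t x) < eps / 2)).
  { intros t. exact (proj2_sig (constructive_indefinite_description _ (Hloc t))). }
  destruct (compactness_value_1d 0 t1 delta) as [d Hd].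
  exists (/ d). intros s x Hs Hx.
  destruct (Rlt_dec (Rabs (w s x)) eps) as [Hlt|Hnlt]; [exact Hlt|exfalso].
  apply (Hd s Hs). intros (t & Ht & Hst & Hdt). apply Hnlt.
  destruct (Hdelta t Ht) as [H1 H2].
  specialize (H1 s Hs Hst x).
  assert (H3 : Rabs (w t x) < eps / 2).
  { apply H2. apply Rle_lt_trans with (2 := Hx).
    apply Rinv_le_contravar; [apply cond_pos | exact Hdt]. }
  replace (w s x) with ((w s x - w t x) + w t x) by ring.
  apply Rle_lt_trans with (1 := Rabs_triang _ _). lra.
Qed.

(** Neighbourhoods of spatial infinity in the strip [[0, t1]] x R: a limit along
    this filter is a limit as |x| tends to infinity, uniform in time. *)
Definition strip_infinity (t1 : R) (P : R * R -> Prop) : Prop :=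
  exists M : R, forall s x, 0 <= s <= t1 -> M < Rabs x -> P (s, x).

#[global] Instance strip_infinity_filter (t1 : R) : Filter (strip_infinity t1).
Proof.
  constructor.
  - now exists 0.
  - intros P Q [M HM] [N HN]. exists (Rmax M N). intros s x Hs Hx.
    pose proof (Rmax_l M N). pose proof (Rmax_r M N).
    split; [apply HM | apply HN]; auto; lra.
  - intros P Q H [M HM]. exists M. auto.
Qed.

Lemma filterlim_strip (T : Rbar) (w : R -> R -> R) (t1 : R) :
  sup_continuous T w ->
  (forall t, 0 <= t -> Rbar_lt t T -> vanishing (w t)) ->
  0 <= t1 -> Rbar_lt t1 T ->
  filterlim (fun z => w (fst z) (snd z)) (strip_infinity t1) (locally 0).
Proof.
  intros Hw Hv H0 HT P [eps HP].
  destruct (uniform_vanishing T w t1 eps Hw Hv H0 HT (cond_pos eps)) as [M HM].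
  exists M. intros s x Hs Hx. apply HP.
  assert (H : Rabs (w s x - 0) < eps); [rewrite Rminus_0_r; auto | exact H].
Qed.

Lemma continuity_RInt_param (f : R -> R -> R) (a b s0 : R) : a <= b ->
  (forall s x, continuity_2d_pt f s x) ->
  continuity_pt (fun s => RInt (f s) a b) s0.
Proof.
  intros Hab Hf. apply continuity_pt_locally. intros eps.
  assert (Hint : forall s, ex_RInt (f s) a b).
  { intros s. apply ex_RInt_continuous_R. intros x. now apply continuity_2d_pt_slice. }
  assert (He : 0 < eps / (b - a + 1)).
  { apply Rdiv_lt_0_compat; [apply cond_pos | lra]. }
  destruct (uniform_continuity_2d_1d' f a b s0 (fun x _ => Hf s0 x) (mkposreal _ He))
    as [d Hd].
  exists d. intros s Hs.
  assert (Hs' : Rabs (s - s0) < d) by exact Hs. apply Rabs_def2 in Hs'.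
  pose proof (cond_pos d) as Hdp.
  replace (RInt (f s) a b - RInt (f s0) a b) with (RInt (fun x => f s x - f s0 x) a b).
  2: { apply (RInt_minus (f s) (f s0)); auto. }
  apply Rle_lt_trans with ((b - a) * (eps / (b - a + 1))).
  - apply abs_RInt_le_const; [exact Hab| |].
    + apply (ex_RInt_minus (f s) (f s0)); auto.
    + intros x Hx. left. apply (Hd x s0 x s); try lra.
      rewrite Rminus_diag, Rabs_R0. exact Hdp.
  - apply Rlt_le_trans with ((b - a + 1) * (eps / (b - a + 1))).
    + apply Rmult_lt_compat_r; lra.
    + right. field. lra.
Qed.

Lemma locally_2d_snd (P : R -> Prop) (x y : R) :
  locally y P -> locally_2d (fun _ v => P v) x y.
Proof. intros [d Hd]. exists d. intros u v _ Hv. apply Hd. exact Hv. Qed.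

(** Symmetry of second derivatives: as p_t = phi holds at all x, it turns p_xt
    into phi_x along a solution. *)
Lemma mixed_derivatives (f : R -> R -> R) (T : Rbar) (x t : R) :
  (forall y s, 0 < s -> Rbar_lt s T -> ex_diff_n f 2 y s) -> 0 < t -> Rbar_lt t T ->
  Derive (fun s => Derive (fun y => f y s) x) t = Derive (fun y => Derive (fun s => f y s) t) x.
Proof.
  intros Hf H0 HT. symmetry. apply Schwarz.
  - generalize (locally_2d_snd _ x t (locally_time T t H0 HT)).
    apply locally_2d_impl. apply locally_2d_forall. intros u v [Hv HvT].
    destruct (Hf u v Hv HvT) as (_ & D1 & D2 & (_ & _ & D3 & _) & (_ & D4 & _)). auto.
  - destruct (Hf x t H0 HT) as (_ & _ & _ & _ & (_ & _ & _ & [Hc _] & _)). exact Hc.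
  - destruct (Hf x t H0 HT) as (_ & _ & _ & (_ & _ & _ & _ & [Hc _]) & _). exact Hc.
Qed.

(** The time derivative of the density of I_2 before any equation is used; its
    explicit form shows its joint continuity. *)
Definition I2_rate (kappa : R) (U : R -> state) (s x : R) : R :=
  - kappa * (Derive (fun r => Derive (sp (U r)) x) s * sphi (U s) x
             + Derive (sp (U s)) x * Derive (fun r => sphi (U r) x) s
             + Derive (fun r => Derive (sq (U r)) x) s * svarphi (U s) x
             + Derive (sq (U s)) x * Derive (fun r => svarphi (U r) x) s)
  + 1 / 2 * (Derive (fun r => Derive (sp (U r)) x) s * sq (U s) x
             + Derive (sp (U s)) x * Derive (fun r => sq (U r) x) s
             - Derive (fun r => sp (U r) x) s * Derive (sq (U s)) x
             - sp (U s) x * Derive (fun r => Derive (sq (U r)) x) s).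

Lemma is_derive_I2_density (kappa beta : R) (V : R -> R -> R) (T : Rbar) (U : R -> state)
  (x t : R) : smooth_evolution kappa beta V T U -> 0 < t -> Rbar_lt t T ->
  is_derive (fun s => I2_density kappa (U s) x) t (I2_rate kappa U t x).
Proof.
  intros (_ & H & _) H0 HT.
  destruct (H x t H0 HT) as ((_ & _ & P & (_ & _ & DP & _) & _) &
    (_ & _ & Q & (_ & _ & DQ & _) & _) & (_ & _ & F & _) & (_ & _ & G & _)).
  assert (Halg : forall p q dp dq f v : R -> R,
    ex_derive p t -> ex_derive q t -> ex_derive dp t -> ex_derive dq t ->
    ex_derive f t -> ex_derive v t ->
    is_derive (fun s => - kappa * (dp s * f s + dq s * v s)
                        + 1 / 2 * (dp s * q s - p s * dq s)) t
      (- kappa * (Derive dp t * f t + dp t * Derive f t + Derive dq t * v t + dq t * Derive v t)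
       + 1 / 2 * (Derive dp t * q t + dp t * Derive q t - Derive p t * dq t - p t * Derive dq t))).
  { intros p q dp dq f v Hp Hq Hdp Hdq Hf Hv. auto_derive.
    - repeat split; assumption.
    - eta_reduce p. eta_reduce q. eta_reduce dp. eta_reduce dq. eta_reduce f. eta_reduce v.
      field. }
  exact (Halg _ _ _ _ _ _ P Q DP DQ F G).
Qed.

Lemma continuity_I2_rate (kappa beta : R) (V : R -> R -> R) (T : Rbar) (U : R -> state)
  (x t : R) : smooth_evolution kappa beta V T U -> 0 < t -> Rbar_lt t T ->
  continuity_2d_pt (I2_rate kappa U) t x.
Proof.
  intros (_ & H & _) H0 HT.
  apply (continuity_2d_pt_swap (fun y s => I2_rate kappa U s y)).
  destruct (H x t H0 HT) as ((P & _ & _ & (Px & _ & _ & _ & [Pxt _]) & (Pt & _)) &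
    (Q & _ & _ & (Qx & _ & _ & _ & [Qxt _]) & (Qt & _)) &
    (F & _ & _ & _ & [Ft _]) & (G & _ & _ & _ & [Gt _])).
  unfold I2_rate.
  cont_2d.
Qed.

(** After replacing p_xt and q_xt by phi_x and psi_x, and kappa phi_t and
    kappa psi_t from the system, the terms combine into an exact x-derivative. *)
Lemma local_conservation (kappa beta : R) (V : R -> R -> R) (f : C -> C) (T : Rbar)
  (U : R -> state) (x t : R) :
  (forall p q : R, Re (f (p, q)) = Vp V p q) ->
  (forall p q : R, Im (f (p, q)) = Vq V p q) ->
  smooth_evolution kappa beta V T U -> solves_system kappa beta f T U ->
  0 < t -> Rbar_lt t T ->
  I2_rate kappa U t x = dflux (- kappa / 2) beta (1 / 2) V (U t) x.
Proof.
  intros Hre Him HU HS H0 HT.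
  assert (Epx : Derive (fun r => Derive (sp (U r)) x) t = Derive (sphi (U t)) x).
  { etransitivity; [apply (mixed_derivatives (fun y s => sp (U s) y) T); auto|].
    - intros y s Hs HsT. apply HU; auto.
    - apply Derive_ext. intros y. apply (HS y t H0 HT). }
  assert (Eqx : Derive (fun r => Derive (sq (U r)) x) t = Derive (svarphi (U t)) x).
  { etransitivity; [apply (mixed_derivatives (fun y s => sq (U s) y) T); auto|].
    - intros y s Hs HsT. apply HU; auto.
    - apply Derive_ext. intros y. apply (HS y t H0 HT). }
  destruct (HS x t H0 HT) as (Ep & Eq & Ef & Ev).
  rewrite Hre in Ef. rewrite Him in Ev.
  unfold I2_rate, dflux. rewrite Epx, Eqx. rewrite Ep in Ev |- *. rewrite Eq in Ef |- *.
  assert (Ef' : kappa * Derive (fun s => sphi (U s) x) t =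
    svarphi (U t) x - beta * Derive_n (sp (U t)) 2 x - Vp V (sp (U t) x) (sq (U t) x)) by lra.
  assert (Ev' : kappa * Derive (fun s => svarphi (U s) x) t =
    - sphi (U t) x - beta * Derive_n (sq (U t)) 2 x - Vq V (sp (U t) x) (sq (U t) x)) by lra.
  revert Ef' Ev'.
  generalize (Derive (fun s => sphi (U s) x) t) (Derive (fun s => svarphi (U s) x) t).
  intros ft vt Ef' Ev'.
  match goal with |- - kappa * (?A + ?a * ft + ?B + ?b * vt) + ?rest = _ =>
    replace (- kappa * (A + a * ft + B + b * vt) + rest)
      with (- kappa * (A + B) - a * (kappa * ft) - b * (kappa * vt) + rest) by ring
  end.
  rewrite Ef', Ev'. field.
Qed.

Lemma is_derive_I2_segment (kappa beta : R) (V : R -> R -> R) (f : C -> C) (T : Rbar)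
  (U : R -> state) (a b t : R) :
  smooth_potential V ->
  (forall p q : R, Re (f (p, q)) = Vp V p q) ->
  (forall p q : R, Im (f (p, q)) = Vq V p q) ->
  smooth_evolution kappa beta V T U -> solves_system kappa beta f T U ->
  0 < t -> Rbar_lt t T ->
  is_derive (fun s => RInt (I2_density kappa (U s)) a b) t
    (flux (- kappa / 2) beta (1 / 2) V (U t) b - flux (- kappa / 2) beta (1 / 2) V (U t) a).
Proof.
  intros HV Hre Him HU HS H0 HT.
  assert (HR : forall s, 0 < s -> Rbar_lt s T -> regular (U s)).
  { intros s Hs HsT. apply (in_space_regular kappa beta V). apply HU; auto; lra. }
  replace (flux (- kappa / 2) beta (1 / 2) V (U t) b - flux (- kappa / 2) beta (1 / 2) V (U t) a)
    with (RInt (fun x => Derive (fun s => I2_density kappa (U s) x) t) a b).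
  - apply (is_derive_RInt_param (fun s x => I2_density kappa (U s) x)).
    + generalize (locally_time T t H0 HT). apply filter_imp. intros s [Hs HsT] x _.
      eexists. now apply (is_derive_I2_density kappa beta V T U).
    + intros x _. apply continuity_2d_pt_ext_loc with (I2_rate kappa U).
      * destruct (locally_time T t H0 HT) as [d Hd]. exists d. intros s y Hs _.
        destruct (Hd s Hs) as [Hs0 HsT]. symmetry. apply is_derive_unique.
        now apply (is_derive_I2_density kappa beta V T U).
      * now apply (continuity_I2_rate kappa beta V T U).
    + generalize (locally_time T t H0 HT). apply filter_imp. intros s [Hs HsT].
      apply ex_RInt_continuous_R. intros x. destruct (HR s Hs HsT).
      unfold I2_density. cont.
  - apply is_RInt_unique.
    apply (is_RInt_ext (dflux (- kappa / 2) beta (1 / 2) V (U t))).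
    + intros x _. symmetry. etransitivity.
      * apply is_derive_unique. now apply (is_derive_I2_density kappa beta V T U).
      * now apply (local_conservation kappa beta V f T U).
    + apply (is_RInt_derive (flux (- kappa / 2) beta (1 / 2) V (U t))).
      * intros x _. apply is_derive_flux; auto.
      * intros x _. apply continuous_dflux; auto.
Qed.

(** The integral over [[-b, b]] is compared at the times 0 and t by the mean
    value theorem; the difference is t times a difference of fluxes at the two
    ends, small for large b uniformly in the intermediate time. *)
Lemma I2_invariant (kappa beta : R) (V : R -> R -> R) (f : C -> C) (T : Rbar)
  (U : R -> state) (t : R) :
  smooth_potential V ->
  (forall p q : R, Re (f (p, q)) = Vp V p q) ->
  (forall p q : R, Im (f (p, q)) = Vq V p q) ->
  smooth_evolution kappa beta V T U -> solves_system kappa beta f T U ->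
  0 <= t -> Rbar_lt t T -> I2 kappa (U t) = I2 kappa (U 0).
Proof.
  intros HV Hre Him HU HS H0 HT.
  pose proof HU as (Hin & _ & Sp & Sq & Sdp & Sdq & Sf & Sv).
  set (J := flux (- kappa / 2) beta (1 / 2) V).
  assert (Hrange : forall s, 0 <= s <= t -> in_space kappa beta V (U s)).
  { intros s Hs. apply Hin; [lra|]. apply (Rbar_le_time T s t); [lra | exact HT]. }
  (* Each component vanishes at spatial infinity uniformly in time. *)
  assert (HJ : filterlim (fun z => J (U (fst z)) (snd z)) (strip_infinity t) (locally (V 0 0))).
  { apply (filterlim_flux (strip_infinity t) _ _ _ V (fun z => U (fst z)) snd HV).
    - apply (filterlim_strip T (fun s => sp (U s))); auto. intros; now apply Hin.
    - apply (filterlim_strip T (fun s => sq (U s))); auto. intros; now apply Hin.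
    - apply (filterlim_strip T (fun s => Derive (sp (U s)))); auto. intros; now apply Hin.
    - apply (filterlim_strip T (fun s => Derive (sq (U s)))); auto. intros; now apply Hin.
    - apply (filterlim_strip T (fun s => sphi (U s))); auto. intros; now apply Hin.
    - apply (filterlim_strip T (fun s => svarphi (U s))); auto. intros; now apply Hin. }
  assert (Hcont : forall s x, continuity_2d_pt (fun r y => I2_density kappa (U (clamp t r)) y) s x).
  { intros s x. unfold I2_density.
    assert (Hreg : forall r, 0 <= r -> Rbar_lt r T -> regular (U r)).
    { intros r Hr HrT. exact (in_space_regular _ _ _ _ (Hin r Hr HrT)). }
    pose proof (sup_continuous_joint T _ t s x Sp (fun r h hT => reg_p_cont _ (Hreg r h hT)) H0 HT).
    pose proof (sup_continuous_joint T _ t s x Sq (fun r h hT => reg_q_cont _ (Hreg r h hT)) H0 HT).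
    pose proof (sup_continuous_joint T _ t s x Sdp (fun r h hT => reg_dp_cont _ (Hreg r h hT)) H0 HT).
    pose proof (sup_continuous_joint T _ t s x Sdq (fun r h hT => reg_dq_cont _ (Hreg r h hT)) H0 HT).
    pose proof (sup_continuous_joint T _ t s x Sf (fun r h hT => reg_phi_cont _ (Hreg r h hT)) H0 HT).
    pose proof (sup_continuous_joint T _ t s x Sv (fun r h hT => reg_vphi_cont _ (Hreg r h hT)) H0 HT).
    cont_2d. }
  assert (HMVT : forall a b, a <= b -> exists c, 0 <= c <= t /\
    RInt (I2_density kappa (U t)) a b - RInt (I2_density kappa (U 0)) a b
    = (J (U c) b - J (U c) a) * t).
  { intros a b Hab.
    destruct (MVT_gen (fun s => RInt (I2_density kappa (U (clamp t s))) a b) 0 t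
      (fun s => J (U s) b - J (U s) a)) as [c [Hc Ec]].
    - intros s Hs. rewrite Rmin_left, Rmax_right in Hs by lra.
      apply is_derive_ext_loc with (fun r => RInt (I2_density kappa (U r)) a b).
      + assert (Hl : locally s (fun r => 0 < r /\ r < t)).
        { apply filter_and; [now apply (open_gt 0) | now apply (open_lt t)]. }
        generalize Hl. apply filter_imp. intros r Hr. now rewrite clamp_id by lra.
      + apply (is_derive_I2_segment kappa beta V f T U); auto; [lra|].
        apply (Rbar_le_time T s t); [lra | exact HT].
    - intros s _.
      exact (continuity_RInt_param (fun r => I2_density kappa (U (clamp t r))) a b s Hab Hcont).
    - rewrite Rmin_left, Rmax_right in Hc by lra. exists c. split; [exact Hc|].
      rewrite !clamp_id in Ec by lra. rewrite Ec. ring. }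
  apply cond_eq. intros eps Heps.
  assert (He : 0 < eps / (4 * (t + 1))) by (apply Rdiv_lt_0_compat; lra).
  assert (He4 : 0 < eps / 4) by lra.
  destruct (HJ (ball (V 0 0) (mkposreal _ He))) as [M HM]; [apply locally_ball|].
  assert (Hi : forall s, 0 <= s <= t -> is_Rint (I2_density kappa (U s)) (I2 kappa (U s))).
  { intros s Hs. apply is_Rint_Rint. apply (Hrange s Hs). }
  destruct (proj1 (is_Rint_iff _ _) (Hi t ltac:(lra)) _ He4) as [M1 HM1].
  destruct (proj1 (is_Rint_iff _ _) (Hi 0 ltac:(lra)) _ He4) as [M2 HM2].
  pose (b := Rabs M + Rabs M1 + Rabs M2 + 1).
  assert (Hb : M < b /\ M1 < b /\ M2 < b /\ 0 < b).
  { unfold b. pose proof (Rle_abs M). pose proof (Rle_abs M1). pose proof (Rle_abs M2).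
    pose proof (Rabs_pos M). pose proof (Rabs_pos M1). pose proof (Rabs_pos M2). lra. }
  destruct (HM1 (- b) b ltac:(lra) ltac:(lra)) as [y1 [Hy1 E1]].
  destruct (HM2 (- b) b ltac:(lra) ltac:(lra)) as [y2 [Hy2 E2]].
  destruct (HMVT (- b) b ltac:(lra)) as [c [Hc Ec]].
  rewrite (is_RInt_unique _ _ _ _ Hy1), (is_RInt_unique _ _ _ _ Hy2) in Ec.
  assert (Jb : Rabs (J (U c) b - V 0 0) < eps / (4 * (t + 1))).
  { apply (HM c b Hc). rewrite Rabs_right; lra. }
  assert (Ja : Rabs (J (U c) (- b) - V 0 0) < eps / (4 * (t + 1))).
  { apply (HM c (- b) Hc). rewrite Rabs_Ropp, Rabs_right; lra. }
  assert (E12 : Rabs (y1 - y2) <= 2 * (eps / (4 * (t + 1))) * t).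
  { rewrite Ec, Rabs_mult, (Rabs_right t) by lra.
    apply Rmult_le_compat_r; [exact H0|].
    apply Rabs_def2 in Jb. apply Rabs_def2 in Ja. apply Rabs_le. lra. }
  assert (Hbound : 2 * (eps / (4 * (t + 1))) * t <= eps / 2).
  { replace (eps / 2) with (2 * (eps / (4 * (t + 1))) * (t + 1)) by (field; lra).
    apply Rmult_le_compat_l; lra. }
  apply Rabs_def2 in E1. apply Rabs_def2 in E2.
  assert (E12' := Rle_trans _ _ _ E12 Hbound). apply Rabs_le_between in E12'.
  apply Rabs_def1; lra.
Qed.

(** * The theorem *)

Theorem mainTheorem3 :
  forall (kappa beta : R) (V : R -> R -> R) (f : C -> C),
  0 < kappa -> 0 < beta ->
  smooth_potential V ->
  (forall p q : R, Re (f (p, q)) = Derive (fun z => V z q) p) ->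
  (forall p q : R, Im (f (p, q)) = Derive (fun z => V p z) q) ->
  (* {I_2, H} = 0, all the objects involved being well defined *)
  (forall U : state, in_space kappa beta V U ->
     is_vderiv (I2 kappa) U (vderiv (I2 kappa) U) /\
     is_vderiv (Ham kappa beta V) U (vderiv (Ham kappa beta V) U) /\
     ex_Rint (poisson_density kappa (I2 kappa) (Ham kappa beta V) U) /\
     poisson kappa (I2 kappa) (Ham kappa beta V) U = 0) /\
  (* the equation, the real first-order system and its Hamiltonian form *)
  (forall (T : Rbar) (U : R -> state), Rbar_lt 0 T ->
     smooth_evolution kappa beta V T U ->
     (solves_system kappa beta f T U <->
        (forall x t : R, 0 < t -> Rbar_lt t T ->
           Cderive (fun s => (sp (U s) x, sq (U s) x)) t
           = (sphi (U t) x, svarphi (U t) x)) /\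
        solves_equation kappa beta f T (fun x t => (sp (U t) x, sq (U t) x))) /\
     (solves_system kappa beta f T U <->
        forall x t : R, 0 < t -> Rbar_lt t T ->
          is_derive_mat (fun s => col (U s) x) t
            (Mmult (Jmat kappa) (col (vderiv (Ham kappa beta V) (U t)) x)))) /\
  (* invariance in time of I_2 *)
  (forall (T : Rbar) (U : R -> state), Rbar_lt 0 T ->
     smooth_evolution kappa beta V T U ->
     solves_system kappa beta f T U ->
     forall t : R, 0 <= t -> Rbar_lt t T -> I2 kappa (U t) = I2 kappa (U 0)) /\
  (* complex form of I_2 *)
  (forall U : state, in_space kappa beta V U ->
     I2 kappa U = I2_complex kappa (fun x => (sp U x, sq U x))
                                   (fun x => (sphi U x, svarphi U x))) /\
  (* spatial translations form a symmetry group of the system *)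
  (forall (U : state) (x : R), col (shift 0 U) x = col U x) /\
  (forall (a b : R) (U : state) (x : R),
     col (shift (a + b) U) x = col (shift a (shift b U)) x) /\
  (forall (eps : R) (U : state),
     in_space kappa beta V U -> in_space kappa beta V (shift eps U)) /\
  (forall (eps : R) (T : Rbar) (U : R -> state), Rbar_lt 0 T ->
     smooth_evolution kappa beta V T U ->
     solves_system kappa beta f T U ->
     smooth_evolution kappa beta V T (fun t => shift eps (U t)) /\
     solves_system kappa beta f T (fun t => shift eps (U t))) /\
  (* infinitesimal generator *)
  (forall (U : state) (x : R), in_space kappa beta V U ->
     let w : @matrix R 4 1 :=
       [ [kappa * Derive (sphi U) x - Derive (sq U) x],
         [Derive (sp U) x + kappa * Derive (svarphi U) x],
         [- kappa * Derive (sp U) x],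
         [- kappa * Derive (sq U) x] ] in
     is_derive_mat (fun eps => col (shift eps U) x) 0 (Mmult (Jmat kappa) w) /\
     Mmult (Jmat kappa) w = Mmult (Jmat kappa) (col (vderiv (I2 kappa) U) x)).
Proof.
  intros kappa beta V f Hk Hb HV Hre Him.
  split; [|split; [|split; [|split; [|split; [|split; [|split; [|split]]]]]]].
  - intros U HU.
    pose proof (is_Rint_bracket kappa beta V U Hk HV HU) as HP.
    split; [exact (proj1 (vderiv_I2 _ _ _ _ HU))|].
    split; [exact (proj1 (vderiv_Ham _ _ _ _ HV HU))|].
    split; [now exists 0 | exact (is_Rint_unique _ _ HP)].
  - intros T U _ HU. split.
    + apply system_complex.
    + now apply system_Hamiltonian.
  - intros T U _ HU HS t H0 HT. now apply (I2_invariant kappa beta V f T U).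
  - intros U _. apply I2_complex_form.
  - intros U x. unfold col, shift; simpl. now rewrite Rplus_0_r.
  - intros a b U x. unfold col, shift; simpl.
    now replace (x + (a + b)) with (x + a + b) by ring.
  - intros eps U. apply in_space_shift.
  - intros eps T U _ HU HS. split.
    + now apply smooth_evolution_shift.
    + now apply solves_system_shift.
  - intros U x HU w. change w with (col (grad_I2 kappa U) x). split.
    + apply shift_generator; [exact Hk | exact (in_space_regular _ _ _ _ HU)].
    + f_equal. symmetry. apply (proj2 (vderiv_I2 _ _ _ _ HU) x).
Qed.
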